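(* Let $d\ge1$, $\alpha\in(0,2)$, and let $\mu_V=\mu_1\otimes\cdots\otimes\mu_d$ be a product measure on $\mathbb{R}^d$ such that for each $1\le i\le d$, $\mu_i(dx_i)=e^{-V_i(x_i)}\,dx_i$ is a probability measure on $\mathbb{R}$, where $V_i$ is a Borel measurable function on $\mathbb{R}$ and $e^{-V_i}$ may be unbounded. Let $(D,\mathscr{D}(D))$ be as in the context. If for each $1\le i\le d$ there exists a constant $C_i>0$ such that for all $x,y\in\mathbb{R}$ with $x\ne y$ $$\frac{e^{V_i(x)}+e^{V_i(y)}}{|x-y|^{1+\alpha}}\ge C_i,$$ then the entropy inequality $$\mathrm{Ent}_{\mu_V}(f)\le 2\Big(\sup_{1\le i\le d}C_i^{-1}\Big)D(f,\log f),\qquad f\in\mathscr{D}(D),\ f>0,$$ holds. In particular, the Poincaré inequality $$\mu_V(f^2)\le C\,D(f,f)+\mu_V(f)^2,\qquad f\in\mathscr{D}(D),$$ also holds with some constant $C>0$.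
   Context: Notation: $e_1,\dots,e_d$ is the standard basis of $\mathbb{R}^d$; $\mu(f)=\int f\,d\mu$. The relative entropy is $\mathrm{Ent}_\mu(f)=\mu(f\log f)-\mu(f)\log\mu(f)$ for $f>0$. Dirichlet form: for $\alpha\in(0,2)$, $$D(f,g)=\frac12\sum_{i=1}^d\int_{\mathbb{R}^d}\int_{\mathbb{R}}\frac{(f(x+ze_i)-f(x))(g(x+ze_i)-g(x))}{|z|^{1+\alpha}}\,dz\,\mu_V(dx),$$ and $\mathscr{D}(D)$ is the closure of $C_c^\infty(\mathbb{R}^d)$ under the norm $(\|f\|_{L^2(\mathbb{R}^d;\mu_V)}^2+D(f,f))^{1/2}$. For $f>0$ the integrand in $D(f,\log f)$ is nonnegative, and $D(f,\log f)\in[0,\infty]$ denotes the value of this integral. *)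

(* Defs.v *)
From HB Require Import structures.
From mathcomp Require Import all_boot all_order all_algebra.
From mathcomp Require Import all_classical all_reals all_analysis.

Set Implicit Arguments.
Unset Strict Implicit.
Unset Printing Implicit Defensive.

Import Order.TTheory GRing.Theory Num.Theory.
Import numFieldNormedType.Exports.

Local Open Scope classical_set_scope.
Local Open Scope ring_scope.

(* R^n is 'rV[R]_n, with the product sigma-algebra generated by the
   coordinates, as the library does for n.-tuple. For T := R : realType this is
   the Borel sigma-algebra of R^n. *)
Definition measure_rV_display : measure_display -> measure_display.
Proof. exact. Qed.

Section measurable_rV.
Context {d : measure_display} {T : measurableType d}.
Variable n : nat.

Let coors : 'I_n -> 'rV[T]_n -> T := fun i x => x ord0 i.

Let rV_set0 : g_sigma_preimage coors set0.
Proof. exact: sigma_algebra0. Qed.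

Let rV_setC A : g_sigma_preimage coors A -> g_sigma_preimage coors (~` A).
Proof. exact: sigma_algebraC. Qed.

Let rV_bigcup (F : (set 'rV[T]_n)^nat) :
  (forall i, g_sigma_preimage coors (F i)) ->
  g_sigma_preimage coors (\bigcup_i (F i)).
Proof. exact: sigma_algebra_bigcup. Qed.

HB.instance Definition _ := @isMeasurable.Build (measure_rV_display d)
  'rV[T]_n (g_sigma_preimage coors) rV_set0 rV_setC rV_bigcup.

End measurable_rV.

Definition gibbs (R : realType) (V : R -> R) (A : set R) : \bar R :=
  (\int[lebesgue_measure]_(x in A) (expR (- V x))%:E)%E.

(* mu is the tensor product of the nu i; for probabilities nu i, the values on
   measurable boxes determine mu. *)
Definition is_product_measure (R : realType) (d : nat)
    (mu : set 'rV[R]_d -> \bar R) (nu : 'I_d -> set R -> \bar R) : Prop :=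
  forall A : 'I_d -> set R, (forall i, measurable (A i)) ->
    mu [set x : 'rV[R]_d | forall i, A i (x ord0 i)] = (\prod_(i < d) nu i (A i))%E.

Definition std_basis (R : realType) (d : nat) (i : 'I_d) : 'rV[R]_d :=
  delta_mx ord0 i.

Fixpoint Ck (R : realType) (d : nat) (k : nat) (f : 'rV[R]_d -> R) : Prop :=
  match k with
  | 0 => continuous f
  | k'.+1 => forall i : 'I_d,
      (forall x, derivable f x (std_basis R i)) /\
      Ck k' ('D_(std_basis R i) f)
  end.

Definition Cc_infty (R : realType) (d : nat) : set ('rV[R]_d -> R) :=
  [set f | (forall k, Ck k f) /\ compact (closure [set x | f x != 0])].

(* The value is meaningful when D(f, g) is an integral of a nonnegative
   function (in particular for g = f and g = log f) or converges absolutely.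
   The integrand at z = 0 is 0. *)
Definition dirichlet (R : realType) (d : nat) (alpha : R)
    (mu : {measure set 'rV[R]_d -> \bar R}) (f g : 'rV[R]_d -> R) : \bar R :=
  (2^-1%:E * \sum_(i < d) \int[mu]_x \int[lebesgue_measure]_z
     ((f (x + z *: std_basis R i) - f x) * (g (x + z *: std_basis R i) - g x)
        / `|z| `^ (1 + alpha))%:E)%E.

Definition dirichlet_norm (R : realType) (d : nat) (alpha : R)
    (mu : {measure set 'rV[R]_d -> \bar R}) (f : 'rV[R]_d -> R) : \bar R :=
  (((\int[mu]_x (f x ^+ 2)%:E) + dirichlet alpha mu f f) `^ 2^-1)%E.

(* The closure of C_c^infty for the norm above; its elements, which are classes
   modulo mu-almost everywhere equality, are given by Borel representatives. *)
Definition dirichlet_domain (R : realType) (d : nat) (alpha : R)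
    (mu : {measure set 'rV[R]_d -> \bar R}) : set ('rV[R]_d -> R) :=
  [set f : 'rV[R]_d -> R | measurable_fun [set: 'rV[R]_d] f /\
    forall e : R, 0 < e ->
      exists2 g, Cc_infty g & (dirichlet_norm alpha mu (f \- g)%R < e%:E)%E].

Definition entropy (R : realType) (d : measure_display) (T : measurableType d)
    (mu : {measure set T -> \bar R}) (f : T -> R) : \bar R :=
  ((\int[mu]_x (f x * ln (f x))%:E)
   - (\int[mu]_x (f x)%:E) * lne (\int[mu]_x (f x)%:E))%E.

(* Main.v *)
(** By the hypothesis, e^{-V(s)} e^{-V(t)} <= C^-1 (e^{-V(s)} + e^{-V(t)}) /
|s - t|^{1 + alpha}, so that, symmetrising, the covariance of f and log f in a
single coordinate is at most C^-1 times the energy of the jumps in that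
coordinate.  Tensorisation follows by averaging out the coordinates one at a
time: log f - log mu(f) is a sum of terms log a - log c, where c is the average
of a over the k-th coordinate, and the Gibbs variational inequality bounds
mu(f (log a - log c)) by the mean of the k-th covariance of f and log f; for the
variance the increments are orthogonal.  This is proved for bounded functions,
bounded away from 0 in the case of the entropy.  Truncation decreases the
Dirichlet form, and dominated convergence concludes, since elements of the
domain are square integrable. *)

Require Import Defs.
From HB Require Import structures.
From mathcomp Require Import all_boot all_order all_algebra.
From mathcomp Require Import all_classical all_reals all_analysis.
From mathcomp Require Import measurable_realfun.
From mathcomp Require Import ring lra.

Set Implicit Arguments.
Unset Strict Implicit.
Unset Printing Implicit Defensive.

Import Order.TTheory GRing.Theory Num.Theory.
Import numFieldNormedType.Exports.

Local Open Scope classical_set_scope.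
Local Open Scope ring_scope.

(** * Coordinates, boxes and the replacement of one coordinate *)

Section coordinates.
Context (R : realType) (d : nat).

(** What is known of [mu] is its values on boxes, whereas the argument integrates out single
    coordinates. The bridge is an invariance: if [x] and [y] are independent with law [mu], then [x]
    with its k-th coordinate replaced by that of [y] again has law [mu]. Averages over a coordinate
    are thus integrals over a second copy of the whole space, and the product of the other
    coordinates is never formed.

    On a line in direction k the Dirichlet form weighs the starting point with its density and the
    jump with Lebesgue measure, while a covariance weighs both endpoints with densities. The double
    integral of increments is twice the covariance, and symmetrising also costs a factor 2; these
    cancel, so the 2 in the theorem only undoes the 1/2 in [dirichlet].

    Positivity is given almost everywhere, so f is first changed on a null set. Since jumps are
    taken with respect to Lebesgue measure, that the Dirichlet form does not see this change rests
    on the densities e^{-V} being positive. *)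

Definition box (A : 'I_d -> set R) : set 'rV[R]_d :=
  [set x | forall i, A i (x ord0 i)].

Definition upd (k : 'I_d) (x : 'rV[R]_d) (t : R) : 'rV[R]_d :=
  \row_j (if j == k then t else x ord0 j).

Lemma upd_upd k (x : 'rV[R]_d) s t : upd k (upd k x s) t = upd k x t.
Proof. by apply/rowP => j; rewrite !mxE; case: eqP. Qed.

Lemma updC j k (x : 'rV[R]_d) s t : j != k ->
  upd j (upd k x s) t = upd k (upd j x t) s.
Proof.
move=> jk; apply/rowP => i; rewrite !mxE; case: (eqVneq i j) => // ->.
by rewrite (negbTE jk).
Qed.

Lemma upd_coord k (x : 'rV[R]_d) t : upd k x t ord0 k = t.
Proof. by rewrite mxE eqxx. Qed.

Lemma upd_shift k (x : 'rV[R]_d) z : x + z *: std_basis R k = upd k x (x ord0 k + z).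
Proof.
apply/rowP => j; rewrite !mxE eqxx /=; case: eqP => [->|_].
  by rewrite mulr1.
by rewrite mulr0 addr0.
Qed.

Lemma measurable_coord (i : 'I_d) :
  measurable_fun [set: 'rV[R]_d] (fun x : 'rV[R]_d => x ord0 i).
Proof.
move=> _ A mA; rewrite setTI; apply: sub_sigma_algebra.
rewrite -bigcup_seq/=; exists i => /=; first by rewrite mem_index_enum.
by exists A => //; rewrite setTI.
Qed.

Lemma measurable_box (A : 'I_d -> set R) : (forall i, measurable (A i)) ->
  measurable (box A).
Proof.
move=> mA; rewrite (_ : box A = \big[setI/setT]_(i < d)
    ((fun x : 'rV[R]_d => x ord0 i) @^-1` A i)).
  apply: bigsetI_measurable => i _.
  by rewrite -[X in measurable X]setTI; apply: measurable_coord.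
rewrite -bigcap_seq; apply/seteqP; split => x /= H i; first by move=> _; exact: H.
by apply: H; rewrite /= mem_index_enum.
Qed.

Definition boxes : set (set 'rV[R]_d) :=
  [set box A | A in [set A | forall i, measurable (A i)]].

(** Together with [boxesI] this makes the boxes a generating pi-system, on which finite measures are
    determined. A coordinate cylinder is the box whose other sides are the whole line. *)
Lemma measurable_boxesE : @measurable _ 'rV[R]_d = <<s boxes >>.
Proof.
apply/seteqP; split => B.
  apply: smallest_sub; first exact: smallest_sigma_algebra.
  move=> C; rewrite -bigcup_seq /= => -[i _ [A mA <-]].
  apply: sub_sigma_algebra; exists (fun j => if j == i then A else setT).
    by move=> j /=; case: ifP.
  rewrite setTI; apply/seteqP; split => x /=.
    by move=> /(_ i); rewrite eqxx.
  by move=> Ax j; case: eqP => // ->.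
apply: smallest_sub; first exact: sigma_algebra_measurable.
by move=> _ [A mA <-]; exact: measurable_box.
Qed.

Lemma boxesI : setI_closed boxes.
Proof.
move=> _ _ [A mA <-] [B mB <-]; exists (fun i => A i `&` B i).
  by move=> i; exact: measurableI.
by apply/seteqP; split => x /= H; [split=> i; case: (H i)|
  move=> i; split; [exact: H.1|exact: H.2]].
Qed.

Lemma measurable_fun_rV d' (T : measurableType d') (f : T -> 'rV[R]_d) :
  (forall i, measurable_fun setT (fun x => f x ord0 i)) -> measurable_fun setT f.
Proof.
move=> mf; apply: (measurability boxes); first exact: measurable_boxesE.
move=> _ [_ [A mA <-] <-]; rewrite setTI.
rewrite (_ : _ @^-1` _ = \big[setI/setT]_(i < d)
    ((fun x => f x ord0 i) @^-1` A i)).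
  apply: bigsetI_measurable => i _.
  by rewrite -[X in measurable X]setTI; apply: mf.
rewrite -bigcap_seq; apply/seteqP; split => x /= H i; first by move=> _; exact: H.
by apply: H; rewrite /= mem_index_enum.
Qed.

Lemma measurable_upd d' (T : measurableType d') k (f : T -> 'rV[R]_d) (g : T -> R) :
  measurable_fun setT f -> measurable_fun setT g ->
  measurable_fun setT (fun x => upd k (f x) (g x)).
Proof.
move=> mf mg; apply: measurable_fun_rV => i.
rewrite [X in measurable_fun _ X](_ : _ =
  if i == k then g else fun x => f x ord0 i); last first.
  by apply/funext => x; rewrite mxE; case: ifP.
case: ifP => // _; exact: (measurableT_comp (measurable_coord i)).
Qed.

(** The new k-th coordinate is borrowed from a second copy of the whole vector, which lets Fubini
    act on one coordinate without splitting the space. *)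
Definition resample (k : 'I_d) (xy : 'rV[R]_d * 'rV[R]_d) : 'rV[R]_d :=
  upd k xy.1 (xy.2 ord0 k).

Lemma measurable_resample k : measurable_fun setT (resample k).
Proof.
apply: measurable_upd; first exact: measurable_fst.
exact: (measurableT_comp (measurable_coord k)).
Qed.

HB.instance Definition _ k :=
  isMeasurableFun.Build _ _ _ _ (resample k) (measurable_resample k).

End coordinates.

(** * Invariance of a product measure under resampling *)

Section resampling.
Context (R : realType) (d : nat) (mu : probability 'rV[R]_d R)
  (nu : 'I_d -> set R -> \bar R).
Hypothesis nuT : forall i, nu i setT = 1%E.
Hypothesis prodmu : is_product_measure mu nu.
Local Open Scope ereal_scope.

Lemma marginal k A : measurable A -> mu [set x : 'rV[R]_d | A (x ord0 k)] = nu k A.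
Proof.
move=> mA.
have := prodmu (A := fun j => if j == k then A else setT).
rewrite (bigD1 k) //= eqxx big1 ?mule1; last first.
  by move=> i /negbTE ->; exact: nuT.
move=> <-; last by move=> i; case: ifP.
congr (mu _); apply/seteqP; split => x /=.
  by move=> Ax j; case: eqP => // ->.
by move=> /(_ k); rewrite eqxx.
Qed.

(** The preimage of a box is a rectangle: the box with its k-th side freed, times a cylinder over
    that side. Its measure is the same product of the [nu j (B j)]. *)
Lemma resample_measure k A : measurable A ->
  pushforward (mu \x mu) (resample k) A = mu A.
Proof.
apply: (measure_unique (@boxes R d) (fun=> setT)).
- exact: measurable_boxesE.
- exact: boxesI.
- by move=> _; exists (fun=> setT) => //; apply/seteqP; split.
- by apply/seteqP; split => // x _; exists O.
- move=> _ [B mB <-]; change ((mu \x mu) (resample k @^-1` box B) = mu (box B)).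
  have -> : resample k @^-1` box B = box (fun j => if j == k then setT else B j) `*`
     [set y : 'rV[R]_d | B k (y ord0 k)].
    apply/seteqP; split => -[x y] /=.
      move=> H; split; last by have := H k; rewrite upd_coord.
      by move=> j; have := H j; rewrite mxE; case: ifP.
    by move=> [H1 H2] j; rewrite mxE; case: eqP => [->//|/eqP jk];
      have := H1 j; rewrite (negbTE jk).
  transitivity (mu (box (fun j => if j == k then setT else B j)) *
      mu [set y : 'rV[R]_d | B k (y ord0 k)]).
    apply: product_measure1E; first by apply: measurable_box => j; case: ifP.
    by rewrite -[X in measurable X]setTI; apply: measurable_coord.
  rewrite marginal//.
  have -> : mu (box (fun j => if j == k then setT else B j)) =
      \prod_(j < d) nu j (if j == k then setT else B j).
    by apply: prodmu => j; case: ifP.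
  have -> : mu (box B) = \prod_(j < d) nu j (B j) by exact: prodmu.
  rewrite [RHS](bigD1 k)//= (bigD1 k)//= eqxx nuT mul1e muleC.
  by congr (_ * _); apply: eq_bigr => j /negbTE ->.
- move=> _; change ((mu \x mu) (resample k @^-1` setT) < +oo).
  rewrite preimage_setT -setXTT.
  have -> : (mu \x mu) (setT `*` setT) = mu setT * mu setT.
    exact: product_measure1E.
  by rewrite probability_setT mule1 ltry.
Qed.

Lemma ge0_integral_resample (k : 'I_d) (F : 'rV[R]_d -> \bar R) :
  measurable_fun [set: 'rV[R]_d] F -> (forall x, 0 <= F x) ->
  \int[mu]_x F x = \int[mu]_x \int[mu]_y F (upd k x (y ord0 k)).
Proof.
move=> mF F0.
transitivity (\int[pushforward (mu \x mu) (resample k)]_x F x).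
  by apply: eq_measure_integral => A mA _; apply/esym/resample_measure.
rewrite (ge0_integral_pushforward (measurable_resample k))//.
rewrite preimage_setT fubini_tonelli1//.
  exact: (measurableT_comp mF (measurable_resample k)).
by move=> xy; exact: F0.
Qed.

End resampling.

Lemma measurable_inv_powR_norm (R : realType) dT (T : measurableType dT) (a : R)
    (f : T -> R) : measurable_fun [set: T] f ->
  measurable_fun [set: T] (fun x => (`|f x| `^ a)^-1).
Proof.
move=> mf; under eq_fun do rewrite -powRN.
apply: (measurableT_comp (measurable_powR (- a))).
by apply: measurableT_comp => //; exact: normr_measurable.
Qed.

(** * Integration against densities and translation of Lebesgue measure *)

Section lebesgue_densities.
Context (R : realType).
Local Open Scope ereal_scope.

(** [nu] is absolutely continuous with respect to [m], and its Radon-Nikodym derivative is almost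
    everywhere [p], both having the same integrals over measurable sets. *)
Lemma ge0_integral_density d (T : measurableType d)
    (nu : {finite_measure set T -> \bar R})
    (m : {sigma_finite_measure set T -> \bar R}) (p f : T -> \bar R) :
  measurable_fun [set: T] p -> (forall x, 0 <= p x) ->
  (forall A, measurable A -> nu A = \int[m]_(x in A) p x) ->
  measurable_fun [set: T] f -> (forall x, 0 <= f x) ->
  \int[nu]_x f x = \int[m]_x (f x * p x).
Proof.
move=> mp p0 nup mf f0.
have num : nu `<< m.
  apply/null_content_dominatesP => A mA mA0; rewrite nup//.
  by apply: null_set_integral => //; exact: measurable_funTS.
rewrite -(Radon_Nikodym_SigmaFinite.change_of_variables num)//.
apply: ae_eq_integral => //.
- apply: emeasurable_funM => //.
  exact: measurable_int (Radon_Nikodym_SigmaFinite.f_integrable num).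
- exact: emeasurable_funM.
have /filterS : ae_eq m setT (Radon_Nikodym_SigmaFinite.f nu m) p; last first.
  by apply => x /= H /H ->.
apply: integral_ae_eq => //.
  exact: Radon_Nikodym_SigmaFinite.f_integrable.
by move=> E _ mE; rewrite -Radon_Nikodym_SigmaFinite.f_integral// nup.
Qed.

Definition shiftl (a : R) : measurableTypeR R -> measurableTypeR R := fun t => (a + t)%R.

Lemma measurable_shiftl a : measurable_fun setT (shiftl a).
Proof. exact: measurable_funD. Qed.

HB.instance Definition _ a :=
  isMeasurableFun.Build _ _ _ _ (shiftl a) (measurable_shiftl a).

(** Lebesgue measure is determined by the lengths of the intervals []b, c]], which translation
    preserves. *)
Lemma lebesgue_measure_shiftl a A : measurable A ->
  pushforward lebesgue_measure (shiftl a) A = lebesgue_measure A.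
Proof.
move=> mA; apply/esym/lebesgue_measure_unique => //= _ [[b c]] _ <-.
rewrite /pushforward.
have -> : shiftl a @^-1` [set` `]b, c]] = [set` `](b - a)%R, (c - a)%R]].
  by apply/seteqP; split => x /=; rewrite !in_itv/= /shiftl ltrBlDl lerBrDl.
rewrite !lebesgue_measure_itv/= !lte_fin ltrD2r; case: ifP => // _.
by rewrite -!EFinB; congr _%:E; ring.
Qed.

Lemma ge0_integral_shiftl (a : R) (f : R -> \bar R) :
  measurable_fun [set: R] f -> (forall t, 0 <= f t) ->
  \int[lebesgue_measure]_t f t = \int[lebesgue_measure]_z f (a + z)%R.
Proof.
move=> mf f0.
transitivity (\int[pushforward lebesgue_measure (shiftl a)]_t f t).
  by apply: eq_measure_integral => A mA _; apply/esym/lebesgue_measure_shiftl.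
by rewrite (ge0_integral_pushforward (measurable_shiftl a)).
Qed.

(* [lebesgue_measure] lives on the type [measurableTypeR R], which has the same
   measurable sets as the canonical measurable type [R] but another display. *)
Definition lebR : set R -> \bar R := @lebesgue_measure R.

Let lebR0 : lebR set0 = 0. Proof. exact: (measure0 (@lebesgue_measure R)). Qed.

Let lebR_ge0 A : 0 <= lebR A.
Proof. exact: (measure_ge0 (@lebesgue_measure R)). Qed.

Let lebR_sigma_additive : semi_sigma_additive lebR.
Proof. exact: (@measure_semi_sigma_additive _ _ _ (@lebesgue_measure R)). Qed.

HB.instance Definition _ := isMeasure.Build _ _ _ lebR
  lebR0 lebR_ge0 lebR_sigma_additive.

Let lebR_sigma_finite : sigma_finite setT lebR.
Proof. exact: (@sigma_finiteT _ _ _ (@lebesgue_measure R)). Qed.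

HB.instance Definition _ := Measure_isSigmaFinite.Build _ _ _ lebR
  lebR_sigma_finite.

Definition toR (t : measurableTypeR R) : R := t.

Let measurable_toR : measurable_fun setT toR.
Proof. by move=> _ Y mY; rewrite setTI. Qed.

HB.instance Definition _ := isMeasurableFun.Build _ _ _ _ toR measurable_toR.

Lemma ge0_integral_lebR (f : R -> \bar R) :
  measurable_fun [set: R] f -> (forall t, 0 <= f t) ->
  \int[lebesgue_measure]_t f t = \int[lebR]_t f t.
Proof.
move=> mf f0.
transitivity (\int[pushforward lebesgue_measure toR]_t f t).
  by rewrite (ge0_integral_pushforward measurable_toR).
by apply: eq_measure_integral => A mA _.
Qed.

Lemma integral_lebR (f : R -> \bar R) : measurable_fun [set: R] f ->
  \int[lebesgue_measure]_t f t = \int[lebR]_t f t.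
Proof.
move=> mf; rewrite integralE [RHS]integralE !ge0_integral_lebR//.
  exact: measurable_funeneg.
exact: measurable_funepos.
Qed.

Lemma ge0_integral_lebR_shift (a : R) (f : R -> \bar R) :
  measurable_fun [set: R] f -> (forall t, 0 <= f t) ->
  \int[lebR]_t f t = \int[lebR]_z f (a + z)%R.
Proof.
move=> mf f0; rewrite -!ge0_integral_lebR//; first exact: ge0_integral_shiftl.
by apply: (measurableT_comp mf); exact: measurable_funD.
Qed.

End lebesgue_densities.

(** * Comparison of resampling with jumps on a line *)

Lemma iterated_integral_le_sym (R : realType) dT (T : measurableType dT)
    (m : {sigma_finite_measure set T -> \bar R}) (g f1 f2 : T * T -> \bar R) (c : R) :
  (0 <= c)%R ->
  measurable_fun [set: T * T] g -> (forall st, 0 <= g st)%E ->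
  measurable_fun [set: T * T] f1 -> (forall st, 0 <= f1 st)%E ->
  measurable_fun [set: T * T] f2 -> (forall st, 0 <= f2 st)%E ->
  (forall s t, f2 (s, t) = f1 (t, s)) ->
  (forall st, g st <= c%:E * (f1 st + f2 st))%E ->
  (\int[m]_s \int[m]_t g (s, t) <= (2 * c)%:E * \int[m]_s \int[m]_t f1 (s, t))%E.
Proof.
move=> c0 mg g0 mf1 f10 mf2 f20 f21 gf.
have A (f : T * T -> \bar R) : measurable_fun [set: T * T] f ->
    (forall st, 0 <= f st)%E ->
    (\int[m \x m]_st f st = \int[m]_s \int[m]_t f (s, t))%E.
  by move=> mf f0; exact: fubini_tonelli1.
(* [f2] is the transpose of [f1], so exchanging the integrals gives both the same value; hence the
   factor 2. *)
have E : (\int[m]_s \int[m]_t f2 (s, t) = \int[m]_s \int[m]_t f1 (s, t))%E.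
  rewrite fubini_tonelli//.
  by apply: eq_integral => s _; apply: eq_integral => t _; exact: f21.
have -> : ((2 * c)%:E * \int[m]_s \int[m]_t f1 (s, t) =
   c%:E * \int[m \x m]_st (f1 st + f2 st))%E.
  rewrite [in RHS]ge0_integralD//.
  rewrite (A f1)// (A f2)// E.
  by rewrite mulrC EFinM -muleA mule_natl mule2n.
rewrite -A//.
rewrite -ge0_integralZl//; last 2 first.
- exact: emeasurable_funD.
- by move=> st _; exact: adde_ge0.
apply: ge0_le_integral => //.
by apply: emeasurable_funM => //; exact: emeasurable_funD.
Qed.

Section comparison_1d.
Context (R : realType) (alpha C : R) (V : R -> R) (G : R -> R -> R)
  (m : {sigma_finite_measure set R -> \bar R}).
Hypothesis C_gt0 : 0 < C.
Hypothesis mV : measurable_fun [set: R] V.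
Hypothesis C_le : forall x y : R, x != y ->
  C <= (expR (V x) + expR (V y)) / `|x - y| `^ (1 + alpha).
Hypothesis mG : measurable_fun [set: R * R] (fun st => G st.1 st.2).
Hypothesis G0 : forall s t, 0 <= G s t.
Hypothesis Gxx : forall s, G s s = 0.
Hypothesis GC : forall s t, G s t = G t s.

Let p (t : R) := expR (- V t).

Let mp : measurable_fun [set: R] p.
Proof. by apply: measurableT_comp => //; exact: measurableT_comp. Qed.

Let H s t := G s t / `|s - t| `^ (1 + alpha).

Let H0 s t : 0 <= H s t.
Proof. by rewrite divr_ge0// powR_ge0. Qed.

Let HC s t : H s t = H t s.
Proof. by rewrite /H GC distrC. Qed.

Let mH : measurable_fun [set: R * R] (fun st => H st.1 st.2).
Proof.
apply: measurable_funM => //.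
by apply: measurable_inv_powR_norm; exact: measurable_funB.
Qed.

Let mH1 : measurable_fun [set: R * R] (fun st => (H st.1 st.2 * p st.1)%:E).
Proof.
apply/measurable_EFinP/measurable_funM => //.
exact: (measurableT_comp mp).
Qed.

Let mH2 : measurable_fun [set: R * R] (fun st => (H st.1 st.2 * p st.2)%:E).
Proof.
apply/measurable_EFinP/measurable_funM => //.
exact: (measurableT_comp mp).
Qed.

Let mGpp : measurable_fun [set: R * R] (fun st => (G st.1 st.2 * p st.1 * p st.2)%:E).
Proof.
by apply/measurable_EFinP/measurable_funM => //;
  [apply: measurable_funM => //|]; exact: (measurableT_comp mp).
Qed.

Let p_gt0 s : 0 < p s. Proof. exact: expR_gt0. Qed.

(** Multiply the hypothesis by [p s * p t]: each [expR (V _)] cancels one density and leaves the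
    other. It says nothing on the diagonal, where [G] vanishes. *)
Lemma density_product_le s t :
  G s t * p s * p t <= C^-1 * (H s t * p s + H s t * p t).
Proof.
have [->|st] := eqVneq s t.
  by rewrite Gxx !mul0r mulr_ge0// ?invr_ge0 ?(ltW C_gt0)// addr_ge0// mulr_ge0// ltW.
have n0 : 0 < `|s - t| `^ (1 + alpha) by rewrite powR_gt0// normr_gt0 subr_eq0.
have := C_le st; rewrite ler_pdivlMr// => Cle.
rewrite -mulrDr /H -(ler_pM2l C_gt0) mulVKf ?gt_eqF//.
rewrite -(ler_pM2r n0).
have -> : G s t / `|s - t| `^ (1 + alpha) * (p s + p t) * `|s - t| `^ (1 + alpha)
   = G s t * (p s + p t).
  by rewrite mulrAC mulrVK// unitfE gt_eqF.
have pV u : expR (V u) * p u = 1 by rewrite /p expRN divff// gt_eqF// expR_gt0.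
have -> : p s + p t = (expR (V s) + expR (V t)) * (p s * p t).
  by rewrite mulrDl mulrA pV mul1r mulrCA pV mulr1 addrC.
rewrite [leLHS](_ : _ = G s t * (p s * p t) * (C * `|s - t| `^ (1 + alpha))); last by ring.
rewrite [leRHS](_ : _ = G s t * (p s * p t) * (expR (V s) + expR (V t))); last by ring.
by rewrite ler_wpM2l// mulr_ge0// mulr_ge0// ltW.
Qed.

Local Open Scope ereal_scope.

(** The pointwise bound has a term weighted at [s] and one weighted at [t]. As [H] is symmetric they
    have the same integral, and only the weight at the starting point remains, as in the Dirichlet
    form. *)
Lemma comparison_1d :
  \int[m]_s \int[m]_t (G s t * p s * p t)%:E <=
  (2 / C)%:E * \int[m]_s \int[m]_t (H s t * p s)%:E.
Proof.
apply: (@iterated_integral_le_sym R _ _ m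
  (fun st => (G st.1 st.2 * p st.1 * p st.2)%:E)
  (fun st => (H st.1 st.2 * p st.1)%:E)
  (fun st => (H st.1 st.2 * p st.2)%:E)).
- by rewrite invr_ge0 ltW.
- exact: mGpp.
- by move=> st; rewrite lee_fin mulr_ge0// ?mulr_ge0// ltW.
- exact: mH1.
- by move=> st; rewrite lee_fin mulr_ge0// ltW.
- exact: mH2.
- by move=> st; rewrite lee_fin mulr_ge0// ltW.
- by move=> s t /=; rewrite HC.
- by move=> st; rewrite -EFinD -EFinM lee_fin density_product_le.
Qed.

End comparison_1d.

(** * The comparison in one coordinate of the product space *)

Section comparison.
Context (R : realType) (d : nat) (V : 'I_d -> R -> R) (mu : probability 'rV[R]_d R).
Hypothesis mV : forall i, measurable_fun [set: R] (V i).
Hypothesis probV : forall i, gibbs (V i) [set: R] = 1%E.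
Hypothesis prodmu : is_product_measure mu (fun i => gibbs (V i)).
Local Notation leb := (@lebR R).
Local Open Scope ereal_scope.

Definition coord (k : 'I_d) (x : 'rV[R]_d) : R := x ord0 k.

HB.instance Definition _ k :=
  isMeasurableFun.Build _ _ _ _ (coord k) (measurable_coord k).

Lemma measurable_expRN k : measurable_fun [set: R] (fun t => expR (- V k t)).
Proof. by apply: measurableT_comp => //; exact: measurableT_comp. Qed.

Lemma gibbsE k A : measurable A ->
  gibbs (V k) A = \int[leb]_(t in A) (expR (- V k t))%:E.
Proof.
move=> mA; rewrite /gibbs integral_mkcond [RHS]integral_mkcond ge0_integral_lebR//.
  apply/(measurable_restrictT _ mA)/measurable_funTS/measurable_EFinP.
  exact: measurable_expRN.
by move=> t; apply: erestrict_ge0 => s _; rewrite lee_fin expR_ge0.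
Qed.

Lemma ge0_integral_coord (k : 'I_d) (G : R -> \bar R) :
  measurable_fun [set: R] G -> (forall t, 0 <= G t) ->
  \int[mu]_y G (y ord0 k) = \int[leb]_t (G t * (expR (- V k t))%:E).
Proof.
move=> mG G0.
transitivity (\int[distribution mu (coord k)]_t G t).
  by rewrite ge0_integral_distribution.
apply: (ge0_integral_density (p := fun t => (expR (- V k t))%:E)) => //.
- by apply/measurable_EFinP; exact: measurable_expRN.
- by move=> A mA; rewrite -gibbsE//; exact: (marginal probV prodmu k mA).
Qed.

Lemma ge0_integral_resample_density (k : 'I_d) (F : 'rV[R]_d -> \bar R) :
  measurable_fun [set: 'rV[R]_d] F -> (forall x, 0 <= F x) ->
  \int[mu]_x F x = \int[mu]_x \int[leb]_t (F (upd k x t) * (expR (- V k t))%:E).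
Proof.
move=> mF F0; rewrite (ge0_integral_resample probV prodmu k)//.
apply: eq_integral => x _.
rewrite (ge0_integral_coord k (G := fun t => F (upd k x t)))//.
by apply: (measurableT_comp mF); exact: measurable_upd.
Qed.

Section jumps.
Context (alpha C : R) (k : 'I_d) (F : 'rV[R]_d -> 'rV[R]_d -> R).
Hypothesis C_gt0 : (0 < C)%R.
Hypothesis C_le : forall x y : R, x != y ->
  (C <= (expR (V k x) + expR (V k y)) / `|x - y| `^ (1 + alpha))%R.
Hypothesis mF : measurable_fun [set: 'rV[R]_d * 'rV[R]_d] (fun xy => F xy.1 xy.2).
Hypothesis F0 : forall x y, (0 <= F x y)%R.
Hypothesis Fxx : forall x, F x x = 0%R.
Hypothesis FC : forall x y, F x y = F y x.

Let p (t : R) := expR (- V k t).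

Let mF2 dT (T : measurableType dT) (f g : T -> 'rV[R]_d) :
  measurable_fun [set: T] f -> measurable_fun [set: T] g ->
  measurable_fun [set: T] (fun x => F (f x) (g x)).
Proof.
move=> mf mg; exact: (measurableT_comp mF (measurable_fun_pair mf mg)).
Qed.

Let I (x : 'rV[R]_d) := \int[mu]_y (F x (upd k x (y ord0 k)))%:E.
Let J (x : 'rV[R]_d) :=
  \int[leb]_z (F x (upd k x (x ord0 k + z)) / `|z| `^ (1 + alpha))%:E.

Let mI : measurable_fun [set: 'rV[R]_d] I.
Proof.
apply: (measurable_fun_fubini_tonelli_F
  (fun xy : 'rV[R]_d * 'rV[R]_d => (F xy.1 (upd k xy.1 (xy.2 ord0 k)))%:E)).
  apply/measurable_EFinP/mF2 => //; apply: measurable_upd => //.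
  exact: (measurableT_comp (measurable_coord k)).
by move=> xy; rewrite lee_fin.
Qed.

Let mJ : measurable_fun [set: 'rV[R]_d] J.
Proof.
apply: (measurable_fun_fubini_tonelli_F
  (fun xz : 'rV[R]_d * R =>
    (F xz.1 (upd k xz.1 (xz.1 ord0 k + xz.2)) / `|xz.2| `^ (1 + alpha))%:E)).
  apply/measurable_EFinP/measurable_funM; last exact: measurable_inv_powR_norm.
  apply: mF2 => //; apply: measurable_upd => //; apply: measurable_funD => //.
  exact: (measurableT_comp (measurable_coord k)).
by move=> xz; rewrite lee_fin divr_ge0// powR_ge0.
Qed.

Let I0 x : 0 <= I x.
Proof. by apply: integral_ge0 => y _; rewrite lee_fin. Qed.

Let J0 x : 0 <= J x.
Proof. by apply: integral_ge0 => y _; rewrite lee_fin divr_ge0// powR_ge0. Qed.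

Let mupd1 (w : 'rV[R]_d) : measurable_fun [set: R] (upd k w).
Proof. exact: measurable_upd. Qed.

Let mslice (L : 'rV[R]_d -> \bar R) : measurable_fun [set: 'rV[R]_d] L ->
  (forall x, 0 <= L x) ->
  measurable_fun [set: 'rV[R]_d] (fun w => \int[leb]_s (L (upd k w s) * (p s)%:E)).
Proof.
move=> mL L0; apply: (measurable_fun_fubini_tonelli_F
  (fun ws : 'rV[R]_d * R => L (upd k ws.1 ws.2) * (p ws.2)%:E)).
  apply: emeasurable_funM.
    by apply: (measurableT_comp mL); exact: measurable_upd.
  apply/measurable_EFinP.
  by apply: (measurableT_comp (measurable_expRN k)); exact: measurable_snd.
by move=> ws; rewrite mule_ge0// lee_fin expR_ge0.
Qed.

Let I_slice w s : I (upd k w s) * (p s)%:E =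
  \int[leb]_t (F (upd k w s) (upd k w t) * p s * p t)%:E.
Proof.
rewrite /I; under eq_integral do rewrite upd_upd.
rewrite (ge0_integral_coord k (G := fun t => (F (upd k w s) (upd k w t))%:E)).
- rewrite -ge0_integralZr//.
  + by apply: eq_integral => t _; rewrite -!EFinM mulrAC.
  + apply: emeasurable_funM; apply/measurable_EFinP; last exact: measurable_expRN.
    by apply: mF2 => //; exact: measurable_cst.
  + by move=> t _; rewrite mule_ge0// lee_fin ?expR_ge0.
  + by rewrite lee_fin expR_ge0.
- by apply/measurable_EFinP; apply: mF2 => //; exact: measurable_cst.
- by move=> t; rewrite lee_fin.
Qed.

(** Translation invariance allows the substitution [t = s + z], which turns the jump size into the
    distance between the two values of the coordinate. *)
Let J_slice w s : J (upd k w s) * (p s)%:E =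
  \int[leb]_t (F (upd k w s) (upd k w t) / `|s - t| `^ (1 + alpha) * p s)%:E.
Proof.
have m1 : measurable_fun [set: R] (fun t =>
    (F (upd k w s) (upd k w t) / `|s - t| `^ (1 + alpha))%R).
  apply: measurable_funM; first by apply: mF2 => //; exact: measurable_cst.
  by apply: measurable_inv_powR_norm; apply: measurable_funB => //; exact: measurable_cst.
have p1 t : (0 <= F (upd k w s) (upd k w t) / `|s - t| `^ (1 + alpha))%R.
  by rewrite divr_ge0// powR_ge0.
have Z (h : R -> R) (c : R) : measurable_fun [set: R] h -> (forall t, 0 <= h t)%R ->
    (0 <= c)%R -> (\int[leb]_z (h (s + z)%R)%:E) * c%:E = \int[leb]_t (h t * c)%:E.
  move=> mh h0 c0.
  rewrite -(ge0_integral_lebR_shift s (f := EFin \o h)); last 2 first.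
  - exact/measurable_EFinP.
  - by move=> t; rewrite lee_fin.
  rewrite -ge0_integralZr//; first exact/measurable_EFinP.
  by move=> t _; rewrite lee_fin.
rewrite -(Z _ (p s) m1 p1 (expR_ge0 _)); apply: (congr1 (mule^~ (p s)%:E)).
by apply: eq_integral => z _; rewrite upd_upd upd_coord opprD addNKr normrN.
Qed.

(** The k-th coordinate of the base point is resampled as well. With the other coordinates frozen in
    [w], both sides become double integrals over two values [s], [t] of the k-th coordinate, where
    [comparison_1d] applies. *)
Lemma jump_comparison :
  \int[mu]_x \int[mu]_y (F x (upd k x (y ord0 k)))%:E <=
  (2 / C)%:E * \int[mu]_x \int[leb]_z
    (F x (upd k x (x ord0 k + z)) / `|z| `^ (1 + alpha))%:E.
Proof.
rewrite -/(\int[mu]_x I x) -/(\int[mu]_x J x).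
rewrite (ge0_integral_resample_density k mI I0).
rewrite (ge0_integral_resample_density k mJ J0).
rewrite -ge0_integralZl//; last 3 first.
- exact: mslice.
- by move=> w _; apply: integral_ge0 => s _; rewrite mule_ge0// lee_fin expR_ge0.
- by rewrite lee_fin divr_ge0// ltW.
apply: ge0_le_integral => //.
- by move=> w _; apply: integral_ge0 => s _; rewrite mule_ge0// lee_fin expR_ge0.
- exact: mslice.
- by apply: emeasurable_funM => //; exact: mslice.
move=> w _.
under eq_integral do rewrite I_slice.
under [in leRHS]eq_integral do rewrite J_slice.
apply: comparison_1d => //.
by apply: mF2; exact: measurable_upd.
Qed.

End jumps.

End comparison.

(** * Bounded measurable functions under a probability *)

Section bounded_measurable.
Context d (T : measurableType d) (R : realType) (P : probability T R).
Implicit Types f g : T -> R.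

(** A class stable under sums and products and integrable for every probability, so that real-valued
    integrals can be computed with freely. *)
Definition bdm f :=
  measurable_fun [set: T] f /\ exists M, forall x, `|f x| <= M.

Lemma bdm_cst (c : R) : bdm (fun=> c).
Proof. by split; [exact: measurable_cst|exists `|c|]. Qed.

Lemma bdmD f g : bdm f -> bdm g -> bdm (fun x => f x + g x).
Proof.
move=> [mf [M fM]] [mg [N gN]]; split; first exact: measurable_funD.
by exists (M + N) => x; rewrite (le_trans (ler_normD _ _))// lerD.
Qed.

Lemma bdmB f g : bdm f -> bdm g -> bdm (fun x => f x - g x).
Proof.
move=> [mf [M fM]] [mg [N gN]]; split; first exact: measurable_funB.
by exists (M + N) => x; rewrite (le_trans (ler_normB _ _))// lerD.
Qed.

Lemma bdmM f g : bdm f -> bdm g -> bdm (fun x => f x * g x).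
Proof.
move=> [mf [M fM]] [mg [N gN]]; split; first exact: measurable_funM.
by exists (M * N) => x; rewrite normrM ler_pM.
Qed.

Lemma bdm_ln f (e M : R) : measurable_fun [set: T] f -> 0 < e ->
  (forall x, e <= f x <= M) -> bdm (fun x => ln (f x)).
Proof.
move=> mf e0 fb; split; first exact: (measurableT_comp (@measurable_ln R)).
exists (`|ln e| + `|ln M|) => x; have /andP[ef fM] := fb x.
have f0 : 0 < f x by exact: lt_le_trans ef.
have M0 : 0 < M by exact: lt_le_trans fM.
have h1 : ln e <= ln (f x) by rewrite ler_ln.
have h2 : ln (f x) <= ln M by rewrite ler_ln.
rewrite ler_norml; apply/andP; split.
  have := ler_norm (- ln e); rewrite normrN; have := normr_ge0 (ln M); lra.
by have := ler_norm (ln M); have := normr_ge0 (ln e); lra.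
Qed.

Lemma bdmV f (e : R) : measurable_fun [set: T] f -> 0 < e ->
  (forall x, e <= f x) -> bdm (fun x => (f x)^-1).
Proof.
move=> mf e0 ef; have f0 x : 0 < f x by exact: lt_le_trans (ef x).
split.
  under eq_fun => x do rewrite -powR_inv1 ?(ltW (f0 x))//.
  exact: (measurableT_comp (measurable_powR (-1))).
by exists e^-1 => x; rewrite gtr0_norm ?invr_gt0// lef_pV2// posrE.
Qed.

Lemma bdm_integrable f : bdm f -> P.-integrable [set: T] (EFin \o f).
Proof.
move=> [mf [M fM]].
apply: (@le_integrable _ _ _ P _ measurableT _ (EFin \o cst M)).
- exact/measurable_EFinP.
- by move=> x _; rewrite !abse_EFin lee_fin (le_trans (fM x))// ler_norm.
- exact: finite_measure_integrable_cst.
Qed.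

Lemma EFin_Rintegral f : P.-integrable [set: T] (EFin \o f) ->
  (\int[P]_x f x)%:E = (\int[P]_x (f x)%:E)%E.
Proof. by move=> fi; rewrite /Rintegral fineK//; exact: integrable_fin_num. Qed.

Lemma RintD f g : bdm f -> bdm g ->
  \int[P]_x (f x + g x) = \int[P]_x f x + \int[P]_x g x.
Proof. by move=> bf bg; rewrite RintegralD//; exact: bdm_integrable. Qed.

Lemma RintB f g : bdm f -> bdm g ->
  \int[P]_x (f x - g x) = \int[P]_x f x - \int[P]_x g x.
Proof. by move=> bf bg; rewrite RintegralB//; exact: bdm_integrable. Qed.

Lemma RintZ f c : bdm f -> \int[P]_x (c * f x) = c * \int[P]_x f x.
Proof. by move=> bf; rewrite RintegralZl//; exact: bdm_integrable. Qed.

Lemma Rint_cst c : \int[P]_x c = c.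
Proof.
have -> := Rintegral_cst P measurableT c.
by rewrite [X in fine X](_ : _ = 1%E) ?mulr1//; exact: probability_setT.
Qed.

Lemma Rint_le f g : bdm f -> bdm g -> (forall x, f x <= g x) ->
  \int[P]_x f x <= \int[P]_x g x.
Proof. by move=> bf bg fg; apply: le_Rintegral => //; exact: bdm_integrable. Qed.

Lemma Rint_bounds f e M : bdm f -> (forall x, e <= f x <= M) ->
  e <= \int[P]_x f x <= M.
Proof.
move=> bf fb; apply/andP; split.
  rewrite -[leLHS]Rint_cst; apply: Rint_le => //; first exact: bdm_cst.
  by move=> x; have /andP[] := fb x.
rewrite -[leRHS]Rint_cst; apply: Rint_le => //; first exact: bdm_cst.
by move=> x; have /andP[] := fb x.
Qed.

End bounded_measurable.

(** * Averaging over one coordinate *)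

Section averaging.
Context (R : realType) (d : nat) (mu : probability 'rV[R]_d R)
  (nu : 'I_d -> set R -> \bar R).
Hypothesis nuT : forall i, nu i setT = 1%E.
Hypothesis prodmu : is_product_measure mu nu.
Implicit Types (f g h : 'rV[R]_d -> R) (k : 'I_d).

(** The conditional expectation of [f] given the coordinates other than the k-th, defined at every
    point. *)
Definition avg k f (x : 'rV[R]_d) : R := \int[mu]_y f (upd k x (y ord0 k)).

Definition indep k f := forall x t, f (upd k x t) = f x.

Lemma bdm_upd k x f : bdm f -> bdm (fun y : 'rV[R]_d => f (upd k x (y ord0 k))).
Proof.
move=> [mf [M fM]]; split; last by exists M.
apply: (measurableT_comp mf); apply: measurable_upd; first exact: measurable_cst.
exact: measurable_coord.
Qed.

Lemma avg_bounds k f e M : bdm f -> (forall x, e <= f x <= M) ->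
  forall x, e <= avg k f x <= M.
Proof. by move=> bf fb x; apply: Rint_bounds => //; exact: bdm_upd. Qed.

Lemma bdm_avg k f : bdm f -> bdm (avg k f).
Proof.
move=> bf; have [mf [M fM]] := bf; split; last first.
  exists M => x; rewrite ler_norml; apply: avg_bounds => // y.
  by rewrite -ler_norml.
(* Adding the bound [M] makes the integrand nonnegative, so that Tonelli gives the measurability of
   the partial integral. *)
have -> : avg k f = fun x =>
    fine (\int[mu]_y (f (upd k x (y ord0 k)) + M)%:E) - M.
  apply/funext => x; rewrite -/(Rintegral mu setT (fun y => f (upd k x (y ord0 k)) + M)).
  by rewrite RintD ?Rint_cst ?addrK//; [exact: bdm_upd|exact: bdm_cst].
apply: measurable_funB; last exact: measurable_cst.
apply: measurableT_comp => //.
apply: (measurable_fun_fubini_tonelli_F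
  (fun xy : 'rV[R]_d * 'rV[R]_d => (f (upd k xy.1 (xy.2 ord0 k)) + M)%:E)).
  apply/measurable_EFinP/measurable_funD; last exact: measurable_cst.
  exact: (measurableT_comp mf (measurable_resample k)).
by move=> xy; rewrite lee_fin -lerBlDr sub0r; have := fM (upd k xy.1 (xy.2 ord0 k));
  rewrite ler_norml => /andP[].
Qed.

Lemma Rint_avg k f : bdm f -> \int[mu]_x avg k f x = \int[mu]_x f x.
Proof.
move=> bf; have [mf [M fM]] := bf.
have cM := @bdm_cst _ 'rV[R]_d R M.
(* The same shift by [M]: the resampling identity is for nonnegative functions. *)
apply: (@addIr _ M); rewrite -[in LHS](Rint_cst mu M) -[in RHS](Rint_cst mu M).
rewrite -RintD//; last exact: bdm_avg.
rewrite -RintD// /Rintegral; congr fine.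
rewrite [RHS](ge0_integral_resample nuT prodmu k); last 2 first.
- by apply/measurable_EFinP/measurable_funD => //; exact: measurable_cst.
- by move=> x; rewrite lee_fin -lerBlDr sub0r; have := fM x; rewrite ler_norml => /andP[].
apply: eq_integral => x _.
rewrite -EFin_Rintegral; last first.
  by apply: bdm_integrable; apply: bdmD => //; exact: bdm_upd.
by rewrite RintD// ?Rint_cst//; exact: bdm_upd.
Qed.

Lemma avg_indep k f : indep k (avg k f).
Proof. by move=> x t; rewrite /avg; under eq_Rintegral do rewrite upd_upd. Qed.

Lemma avg_indep_other j k f : indep j f -> indep j (avg k f).
Proof.
have [->|jk] := eqVneq j k; first by move=> _; exact: avg_indep.
move=> fj x t; rewrite /avg; apply: eq_Rintegral => y _.
by rewrite updC 1?eq_sym// fj.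
Qed.

Lemma avgM k g f : indep k g -> bdm f ->
  avg k (fun x => g x * f x) = fun x => g x * avg k f x.
Proof.
move=> gk bf; apply/funext => x; rewrite /avg.
under eq_Rintegral do rewrite gk.
by rewrite RintZ//; exact: bdm_upd.
Qed.

Lemma RintM_avg k g f : indep k g -> bdm g -> bdm f ->
  \int[mu]_x (g x * avg k f x) = \int[mu]_x (g x * f x).
Proof. by move=> gk bg bf; have := Rint_avg k (bdmM bg bf); rewrite avgM. Qed.

(** Averaging is self-adjoint: both sides equal the integral of [avg k f * avg k g], since an
    average is free of the coordinate k. *)
Lemma Rint_avg_sym k f g : bdm f -> bdm g ->
  \int[mu]_x (avg k f x * g x) = \int[mu]_x (f x * avg k g x).
Proof.
move=> bf bg; have ba := bdm_avg k bf; have bb := bdm_avg k bg.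
rewrite -(RintM_avg (k := k))//; last exact: avg_indep.
under [RHS]eq_Rintegral do rewrite mulrC.
rewrite -[RHS](RintM_avg (k := k))//; last exact: avg_indep.
by apply: eq_Rintegral => x _; rewrite mulrC.
Qed.

(** The mean, over the other coordinates, of the covariance in the k-th one. Averaging [g] alone
    suffices because [avg k] is self-adjoint and idempotent. *)
Definition cov k f g := \int[mu]_x (f x * g x) - \int[mu]_x (f x * avg k g x).

Lemma Rint_jumps_inner k f g x : bdm f -> bdm g ->
  \int[mu]_y ((f x - f (upd k x (y ord0 k))) * (g x - g (upd k x (y ord0 k)))) =
  (f x * g x + avg k (fun z => f z * g z) x) -
  (f x * avg k g x + avg k f x * g x).
Proof.
move=> bf bg.
have bu := bdm_upd k x bf; have bv := bdm_upd k x bg.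
have buv := bdm_upd k x (bdmM bf bg).
have c1 := @bdm_cst _ 'rV[R]_d R (f x); have c2 := @bdm_cst _ 'rV[R]_d R (g x).
transitivity (\int[mu]_y ((f x * g x + f (upd k x (y ord0 k)) * g (upd k x (y ord0 k)))
   - (f x * g (upd k x (y ord0 k)) + g x * f (upd k x (y ord0 k))))).
  by apply: eq_Rintegral => y _; ring.
rewrite RintB; [|exact: bdmD (bdmM c1 c2) buv|exact: bdmD (bdmM c1 bv) (bdmM c2 bu)].
rewrite RintD; [|exact: bdmM c1 c2|exact: buv].
rewrite RintD; [|exact: bdmM c1 bv|exact: bdmM c2 bu].
by rewrite Rint_cst !RintZ// (mulrC (g x)).
Qed.

Lemma bdm_jumps k f g : bdm f -> bdm g ->
  bdm (fun x => \int[mu]_y ((f x - f (upd k x (y ord0 k))) *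
                            (g x - g (upd k x (y ord0 k))))).
Proof.
move=> bf bg; under eq_fun do rewrite Rint_jumps_inner//.
apply: bdmB; apply: bdmD; first exact: bdmM.
- exact: bdm_avg (bdmM bf bg).
- exact: bdmM bf (bdm_avg k bg).
- exact: bdmM (bdm_avg k bf) bg.
Qed.

(** On expanding the product, the two diagonal terms have the same mean because averaging preserves
    integrals, and the two mixed terms because it is self-adjoint. *)
Lemma Rint_jumps k f g : bdm f -> bdm g ->
  \int[mu]_x \int[mu]_y ((f x - f (upd k x (y ord0 k))) *
                         (g x - g (upd k x (y ord0 k)))) = 2 * cov k f g.
Proof.
move=> bf bg; have bfg := bdmM bf bg.
under eq_Rintegral do rewrite Rint_jumps_inner//.
have b1 := bdm_avg k bfg; have b2 := bdmM bf (bdm_avg k bg).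
have b3 := bdmM (bdm_avg k bf) bg.
rewrite RintB; [|exact: bdmD|exact: bdmD].
rewrite RintD// RintD// Rint_avg// Rint_avg_sym// /cov; ring.
Qed.

End averaging.

(** * Tensorisation of entropy and variance *)

Section tensorisation.
Context (R : realType) (d : nat) (mu : probability 'rV[R]_d R)
  (nu : 'I_d -> set R -> \bar R).
Hypothesis nuT : forall i, nu i setT = 1%E.
Hypothesis prodmu : is_product_measure mu nu.
Implicit Types (f g h u a : 'rV[R]_d -> R) (k : 'I_d) (s : seq 'I_d).

(** The head of [s] is averaged out first, so an induction on [s] that generalises the function
    meets one increment at a time. *)
Definition avgs s f := foldl (fun g k => avg mu k g) f s.

Lemma bdm_avgs s f : bdm f -> bdm (avgs s f).
Proof. by elim: s f => //= k s IH f bf; apply: IH; exact: bdm_avg. Qed.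

Lemma avgs_bounds s f e M : bdm f -> (forall x, e <= f x <= M) ->
  forall x, e <= avgs s f x <= M.
Proof.
elim: s f => //= k s IH f bf fb.
by apply: IH; [exact: bdm_avg|exact: avg_bounds].
Qed.

Lemma Rint_avgs s f : bdm f -> \int[mu]_x avgs s f x = \int[mu]_x f x.
Proof.
elim: s f => //= k s IH f bf.
by rewrite IH ?(Rint_avg nuT prodmu)//; exact: bdm_avg.
Qed.

Lemma avgs_indep j s f : (j \in s) \/ indep j f -> indep j (avgs s f).
Proof.
elim: s f => /= [|k s IH] f; first by case.
rewrite in_cons => H; apply: IH.
case: H => [/orP[/eqP ->|js]|fj]; first by right; exact: avg_indep.
  by left.
by right; exact: avg_indep_other.
Qed.

(** The point [x] is turned into [y] by replacing its coordinates one after the other, and [g] does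
    not change on the way. *)
Lemma indep_all_cst g : (forall k, indep k g) -> forall x y, g x = g y.
Proof.
move=> gi x y.
pose z s := foldl (fun z k => upd k z (y ord0 k)) x s.
have gz s : g (z s) = g x.
  by rewrite /z; elim/last_ind: s => //= s k IH; rewrite foldl_rcons gi.
have zE s j : z s ord0 j = if j \in s then y ord0 j else x ord0 j.
  rewrite /z; elim/last_ind: s => //= s k IH.
  rewrite foldl_rcons mem_rcons in_cons mxE; case: eqP => [->//|_] /=.
  exact: IH.
by rewrite -(gz (enum 'I_d)); congr g; apply/rowP => j; rewrite zE mem_enum.
Qed.

Lemma avgs_enum f : bdm f -> forall x, avgs (enum 'I_d) f x = \int[mu]_x f x.
Proof.
move=> bf x; rewrite -(Rint_avgs (enum 'I_d))// -[LHS](Rint_cst mu).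
apply: eq_Rintegral => y _; apply: indep_all_cst => k.
by apply: avgs_indep; left; rewrite mem_enum.
Qed.

Section entropy.
Context (u : 'rV[R]_d -> R) (e M : R).
Hypothesis e_gt0 : 0 < e.
Hypothesis bu : bdm u.
Hypothesis ub : forall x, e <= u x <= M.

Let u_gt0 x : 0 < u x.
Proof. by have /andP[+ _] := ub x; exact: lt_le_trans. Qed.

Let bln f : bdm f -> (forall x, e <= f x <= M) -> bdm (fun x => ln (f x)).
Proof. by move=> [mf _] fb; apply: (bdm_ln mf e_gt0 fb). Qed.

(* The Gibbs variational inequality [u ln (a/c) <= u ln (u/v) + v a/c - u] for
   the resampled value [v] of [u]; the last two terms cancel in the mean. *)
Lemma entropy_step k a : bdm a -> (forall x, e <= a x <= M) ->
  \int[mu]_x (u x * (ln (a x) - ln (avg mu k a x))) <=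
  cov mu k u (fun x => ln (u x)).
Proof.
move=> ba ab.
pose c := avg mu k a; pose lu x := ln (u x).
have bc : bdm c by exact: bdm_avg.
have cb : forall x, e <= c x <= M by exact: avg_bounds.
have c_gt0 x : 0 < c x by have /andP[+ _] := cb x; exact: lt_le_trans.
have a_gt0 x : 0 < a x by have /andP[+ _] := ab x; exact: lt_le_trans.
have bV : bdm (fun x => (c x)^-1).
  by apply: (bdmV bc.1 e_gt0) => x; have /andP[] := cb x.
have blu : bdm lu by exact: bln.
have bU : bdm (avg mu k u) by exact: bdm_avg.
have bL : bdm (avg mu k lu) by exact: bdm_avg.
have bw : bdm (fun x => avg mu k u x * (c x)^-1) by exact: bdmM.
(* The variational inequality is integrated over the resampled coordinate with [x] fixed: [v]
   becomes [avg mu k u] and [ln v] becomes [avg mu k lu]. *)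
have pw x : u x * (ln (a x) - ln (c x)) <=
    (u x * lu x - u x * avg mu k lu x) +
    ((avg mu k u x * (c x)^-1) * a x - u x).
  have bv := bdm_upd k x bu; have blv := bdm_upd k x blu.
  have cc r := @bdm_cst _ 'rV[R]_d R r.
  rewrite -[leLHS](Rint_cst mu) [leRHS](_ : _ = \int[mu]_y
    ((u x * lu x - u x * lu (upd k x (y ord0 k))) +
     ((a x * (c x)^-1) * u (upd k x (y ord0 k)) - u x))); last first.
    rewrite RintD; [|exact: bdmB (cc _) (bdmM (cc _) blv)|exact: bdmB (bdmM (cc _) bv) (cc _)].
    rewrite RintB; [|exact: cc|exact: bdmM (cc _) blv].
    rewrite RintB; [|exact: bdmM (cc _) bv|exact: cc].
    rewrite !Rint_cst !RintZ// -/(avg mu k u x) -/(avg mu k lu x).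
    by congr (_ + (_ - _)); ring.
  apply: Rint_le => [|| y].
  - exact: cc.
  - exact: bdmD (bdmB (cc _) (bdmM (cc _) blv)) (bdmB (bdmM (cc _) bv) (cc _)).
  rewrite /lu; set v := u (upd k x (y ord0 k)).
  have v0 : 0 < v by exact: u_gt0.
  (* [1 + ln t <= t] for this [t], multiplied by [u x], is the variational inequality. *)
  pose t := v * a x / (c x * u x).
  have t0 : 0 < t by rewrite divr_gt0// mulr_gt0.
  have := expR_ge1Dx (ln t); rewrite lnK ?posrE// => lt.
  have tE : ln t = ln v + ln (a x) - (ln (c x) + ln (u x)).
    by rewrite /t ln_div ?posrE ?mulr_gt0// !lnM ?posrE.
  have utE : u x * t = a x / c x * v.
    by rewrite /t; field; rewrite !gt_eqF.
  move: lt; rewrite tE -(ler_pM2l (u_gt0 x)) utE; lra.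
apply: (le_trans (Rint_le mu (bdmM bu (bdmB (bln ba ab) (bln bc cb)))
  (bdmD (bdmB (bdmM bu blu) (bdmM bu bL)) (bdmB (bdmM bw ba) bu)) pw)).
rewrite RintD; [|exact: bdmB (bdmM bu blu) (bdmM bu bL)|exact: bdmB (bdmM bw ba) bu].
rewrite RintB; [|exact: bdmM|exact: bdmM].
rewrite RintB; [|exact: bdmM|exact: bu].
(* The factor [avg mu k u / c] is free of the coordinate k, so [a] may be replaced by its average
   [c]; what is left is the mean of [u], which cancels. *)
rewrite -(RintM_avg nuT prodmu (k := k) _ bw ba); last first.
  by move=> x t; rewrite /c !avg_indep.
rewrite [X in _ + (X - _)](_ : _ = \int[mu]_x u x) ?subrr ?addr0//.
rewrite -(Rint_avg nuT prodmu k bu); apply: eq_Rintegral => x _.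
by rewrite mulfVK// gt_eqF// c_gt0.
Qed.

(** [entropy_step] holds for every [a] between the bounds, so [a] can be replaced by its averages
    while [u] stays fixed. *)
Lemma entropy_telescope s a : bdm a -> (forall x, e <= a x <= M) ->
  \int[mu]_x (u x * (ln (a x) - ln (avgs s a x))) <=
  \sum_(k <- s) cov mu k u (fun x => ln (u x)).
Proof.
elim: s a => [|k s IH] a ba ab /=.
  rewrite big_nil; under eq_Rintegral do rewrite subrr mulr0.
  by rewrite Rint_cst.
have bc := bdm_avg mu k ba; have cb := avg_bounds mu k ba ab.
have bd := bdm_avgs s bc; have db := avgs_bounds s bc cb.
rewrite big_cons; apply: le_trans (lerD (entropy_step k ba ab) (IH _ bc cb)).
rewrite -RintD; last 2 first.
- exact: bdmM bu (bdmB (bln ba ab) (bln bc cb)).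
- exact: bdmM bu (bdmB (bln bc cb) (bln bd db)).
apply: Rint_le => [||x]; last by rewrite -mulrDr; lra.
- exact: bdmM bu (bdmB (bln ba ab) (bln bd db)).
- apply: bdmD; first exact: bdmM bu (bdmB (bln ba ab) (bln bc cb)).
  exact: bdmM bu (bdmB (bln bc cb) (bln bd db)).
Qed.

Lemma entropy_tensorisation :
  \int[mu]_x (u x * ln (u x)) - (\int[mu]_x u x) * ln (\int[mu]_x u x) <=
  \sum_(k < d) cov mu k u (fun x => ln (u x)).
Proof.
have blu := bln bu ub.
have := entropy_telescope (enum 'I_d) bu ub.
rewrite big_enum /=; apply: le_trans.
under [leRHS]eq_Rintegral do rewrite avgs_enum// mulrBr [_ * ln (\int[mu]__ _)]mulrC.
rewrite RintB; [|exact: bdmM|exact: bdmM (bdm_cst _ _) bu].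
by rewrite RintZ// lerD2l lerN2 mulrC.
Qed.

End entropy.

Section variance.
Context (f : 'rV[R]_d -> R).
Hypothesis bf : bdm f.

(** [D] is the set of coordinates already averaged out, and the last hypothesis says that [g] is the
    projection of [f] on the functions free of them. With [h = g - avg k g], the left side is the
    squared norm of [h], and also the product of [f - avg k f] with [h]. The inequality of the two
    means bounds it by half of [cov mu k f f] plus half of itself. *)
Lemma variance_step k g (D : pred 'I_d) : bdm g -> (forall j, D j -> indep j g) ->
  (forall h, bdm h -> (forall j, D j -> indep j h) ->
    \int[mu]_x (f x * h x) = \int[mu]_x (g x * h x)) ->
  \int[mu]_x (f x * (g x - avg mu k g x)) <= cov mu k f f.
Proof.
have amgm (r t : R) : r * t <= 2^-1 * (r * r) + 2^-1 * (t * t).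
  by have := sqr_ge0 (r - t); rewrite expr2; lra.
have half (r t : R) : r <= 2^-1 * t + 2^-1 * r -> r <= t by lra.
move=> bg gD fg.
pose c := avg mu k g; pose h x := g x - c x.
have bc : bdm c by exact: bdm_avg.
have bh : bdm h by exact: bdmB.
have bF : bdm (avg mu k f) by exact: bdm_avg.
have hD j : D j -> indep j h.
  move=> Dj x t; rewrite /h /c (gD _ Dj)// avg_indep_other//; exact: gD.
(* [h] is orthogonal to every function free of the coordinate k, in particular to [avg mu k g] and
   to [avg mu k f]. *)
have ort w : bdm w -> indep k w -> \int[mu]_x (w x * h x) = 0.
  move=> bw wk; rewrite /h; under eq_Rintegral do rewrite mulrBr.
  rewrite RintB; [|exact: bdmM|exact: bdmM].
  by rewrite (RintM_avg nuT prodmu wk bw bg) subrr.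
have E1 : \int[mu]_x (f x * h x) = \int[mu]_x (h x * h x).
  rewrite fg//; have oc := ort c bc (@avg_indep _ _ mu k g).
  rewrite -[RHS]addr0 -oc.
  rewrite -RintD; [|exact: bdmM|exact: bdmM].
  by apply: eq_Rintegral => x _; rewrite /h; ring.
have E2 : \int[mu]_x (f x * h x) = \int[mu]_x ((f x - avg mu k f x) * h x).
  rewrite [RHS](_ : _ = \int[mu]_x (f x * h x - avg mu k f x * h x)); last first.
    by apply: eq_Rintegral => x _; rewrite mulrBl.
  rewrite RintB; [|exact: bdmM|exact: bdmM].
  by rewrite (ort _ bF (@avg_indep _ _ mu k f)) subr0.
have E3 : cov mu k f f =
    \int[mu]_x ((f x - avg mu k f x) * (f x - avg mu k f x)).
  have E : \int[mu]_x (avg mu k f x * f x) = \int[mu]_x (avg mu k f x * avg mu k f x).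
    by rewrite (RintM_avg nuT prodmu (@avg_indep _ _ mu k f) bF bf).
  have E' : \int[mu]_x (f x * avg mu k f x) = \int[mu]_x (avg mu k f x * f x).
    by apply: eq_Rintegral => x _; rewrite mulrC.
  rewrite /cov [RHS](_ : _ = \int[mu]_x ((f x * f x - f x * avg mu k f x) -
     (avg mu k f x * f x - avg mu k f x * avg mu k f x))); last first.
    by apply: eq_Rintegral => x _; ring.
  rewrite RintB; [|exact: bdmB (bdmM bf bf) (bdmM bf bF)
                  |exact: bdmB (bdmM bF bf) (bdmM bF bF)].
  rewrite RintB; [|exact: bdmM|exact: bdmM].
  rewrite RintB; [|exact: bdmM|exact: bdmM].
  by rewrite E; lra.
rewrite -/(\int[mu]_x (f x * h x)).
have b1 := bdmB bf bF.
have : \int[mu]_x (f x * h x) <= 2^-1 * cov mu k f f + 2^-1 * \int[mu]_x (f x * h x).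
  rewrite {2}E1 E3 E2 -RintZ; last exact: bdmM.
  rewrite -RintZ; last exact: bdmM.
  have b2 := bdmM (@bdm_cst _ 'rV[R]_d R 2^-1) (bdmM b1 b1).
  have b3 := bdmM (@bdm_cst _ 'rV[R]_d R 2^-1) (bdmM bh bh).
  rewrite -RintD//; apply: Rint_le; [exact: bdmM|exact: bdmD|move=> x].
  exact: amgm.
exact: half.
Qed.

(** The set [D] gains [k] at each step. Against test functions free of k, [avg mu k g] integrates
    like [g], so it is again a projection of [f]. *)
Lemma variance_telescope s g (D : pred 'I_d) : bdm g -> (forall j, D j -> indep j g) ->
  (forall h, bdm h -> (forall j, D j -> indep j h) ->
    \int[mu]_x (f x * h x) = \int[mu]_x (g x * h x)) ->
  \int[mu]_x (f x * (g x - avgs s g x)) <= \sum_(k <- s) cov mu k f f.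
Proof.
elim: s g D => [|k s IH] g D bg gD fg /=.
  rewrite big_nil; under eq_Rintegral do rewrite subrr mulr0.
  by rewrite Rint_cst.
have bc := bdm_avg mu k bg; have bd := bdm_avgs s bc.
have step := variance_step k bg gD fg.
have rest : \int[mu]_x (f x * (avg mu k g x - avgs s (avg mu k g) x)) <=
    \sum_(j <- s) cov mu j f f.
  apply: (IH _ [pred j | (j == k) || D j]) => //.
    move=> j /= /orP[/eqP ->|Dj]; first exact: avg_indep.
    by apply: avg_indep_other; exact: gD.
  move=> h bh hD; rewrite fg//; last by move=> j Dj; apply: hD; rewrite /= Dj orbT.
  have hk : indep k h by apply: hD; rewrite /= eqxx.
  transitivity (\int[mu]_x (h x * g x)).
    by apply: eq_Rintegral => x _; rewrite mulrC.
  rewrite -(RintM_avg nuT prodmu hk bh bg).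
  by apply: eq_Rintegral => x _; rewrite mulrC.
rewrite big_cons; apply: le_trans (lerD step rest).
rewrite -RintD; [|exact: bdmM bf (bdmB bg bc)|exact: bdmM bf (bdmB bc bd)].
apply: Rint_le => [||x]; last by rewrite -mulrDr; lra.
- exact: bdmM bf (bdmB bg bd).
- exact: bdmD (bdmM bf (bdmB bg bc)) (bdmM bf (bdmB bc bd)).
Qed.

Lemma variance_tensorisation :
  \int[mu]_x (f x * f x) - (\int[mu]_x f x) * (\int[mu]_x f x) <=
  \sum_(k < d) cov mu k f f.
Proof.
have := @variance_telescope (enum 'I_d) f pred0 bf.
rewrite big_enum /= => H; apply: le_trans (H _ _) => //.
under [leRHS]eq_Rintegral do rewrite avgs_enum// mulrBr [_ * (\int[mu]__ _)]mulrC.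
rewrite RintB; [|exact: bdmM|exact: bdmM (bdm_cst _ _) bf].
by rewrite RintZ.
Qed.

End variance.

End tensorisation.

(** * Bounding covariances by the Dirichlet form *)

Section dirichlet_bounds.
Context (R : realType) (d : nat) (alpha : R) (V : 'I_d -> R -> R)
  (mu : probability 'rV[R]_d R) (C : 'I_d -> R).
Hypothesis mV : forall i, measurable_fun [set: R] (V i).
Hypothesis probV : forall i, gibbs (V i) [set: R] = 1%E.
Hypothesis prodmu : is_product_measure mu (fun i => gibbs (V i)).
Hypothesis C_gt0 : forall i, 0 < C i.
Hypothesis C_le : forall i (x y : R), x != y ->
  C i <= (expR (V i x) + expR (V i y)) / `|x - y| `^ (1 + alpha).
Local Open Scope ereal_scope.
Implicit Types (k : 'I_d) (f g : 'rV[R]_d -> R).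

Definition energy (k : 'I_d) (f g : 'rV[R]_d -> R) : \bar R :=
  \int[mu]_x \int[lebesgue_measure]_z
     ((f (x + z *: std_basis R k)%R - f x) * (g (x + z *: std_basis R k)%R - g x)
        / `|z| `^ (1 + alpha))%:E.

Let jump (f g : 'rV[R]_d -> R) x y := ((f x - f y) * (g x - g y))%R.

Let mjump dT (T : measurableType dT) (f g : 'rV[R]_d -> R) (a b : T -> 'rV[R]_d) :
  measurable_fun [set: 'rV[R]_d] f -> measurable_fun [set: 'rV[R]_d] g ->
  measurable_fun [set: T] a -> measurable_fun [set: T] b ->
  measurable_fun [set: T] (fun x => jump f g (a x) (b x)).
Proof.
move=> mf mg ma mb.
apply: measurable_funM; apply: measurable_funB; by [exact: (measurableT_comp mf)|
  exact: (measurableT_comp mg)].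
Qed.

Lemma energyE k f g :
  measurable_fun [set: 'rV[R]_d] f -> measurable_fun [set: 'rV[R]_d] g ->
  energy k f g = \int[mu]_x \int[@lebR R]_z
    ((f x - f (upd k x (x ord0 k + z))) * (g x - g (upd k x (x ord0 k + z)))
      / `|z| `^ (1 + alpha))%:E.
Proof.
move=> mf mg; apply: eq_integral => x _.
transitivity (\int[lebesgue_measure]_z
  (jump f g x (upd k x (x ord0 k + z)%R) / `|z| `^ (1 + alpha))%:E).
  by apply: eq_integral => z _; rewrite upd_shift /jump; congr _%:E; ring.
apply: integral_lebR; apply/measurable_EFinP/measurable_funM; last exact: measurable_inv_powR_norm.
apply: mjump => //.
by apply: measurable_upd => //; exact: measurable_funD.
Qed.

Let mkern k (f g : 'rV[R]_d -> R) :
  measurable_fun [set: 'rV[R]_d] f -> measurable_fun [set: 'rV[R]_d] g ->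
  measurable_fun [set: 'rV[R]_d * R] (fun xz =>
    (jump f g xz.1 (upd k xz.1 (xz.1 ord0 k + xz.2)) / `|xz.2| `^ (1 + alpha))%:E).
Proof.
move=> mf mg; apply/measurable_EFinP/measurable_funM; last exact: measurable_inv_powR_norm.
apply: mjump => //; apply: measurable_upd => //; apply: measurable_funD => //.
exact: (measurableT_comp (measurable_coord k)).
Qed.

Let le_kern (u v z : R) : (u <= v)%R ->
  (u / `|z| `^ (1 + alpha))%:E <= (v / `|z| `^ (1 + alpha))%:E.
Proof. by move=> uv; rewrite lee_fin ler_wpM2r// invr_ge0 powR_ge0. Qed.

Lemma energy_ge0 k f g :
  (forall x y, 0 <= (f x - f y) * (g x - g y))%R -> 0 <= energy k f g.
Proof.
move=> fg; apply: integral_ge0 => x _; apply: integral_ge0 => z _.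
by rewrite lee_fin divr_ge0// powR_ge0.
Qed.

Lemma le_energy k f g (f' g' : 'rV[R]_d -> R) :
  measurable_fun [set: 'rV[R]_d] f -> measurable_fun [set: 'rV[R]_d] g ->
  measurable_fun [set: 'rV[R]_d] f' -> measurable_fun [set: 'rV[R]_d] g' ->
  (forall x y, 0 <= (f' x - f' y) * (g' x - g' y) <= (f x - f y) * (g x - g y))%R ->
  energy k f' g' <= energy k f g.
Proof.
move=> mf mg mf' mg' H.
have j'0 x y : (0 <= jump f' g' x y)%R by have /andP[] := H x y.
have jj' x y : (jump f' g' x y <= jump f g x y)%R by have /andP[] := H x y.
have j0 x y := le_trans (j'0 x y) (jj' x y).
have m1 := mkern k mf' mg'; have m2 := mkern k mf mg.
rewrite !energyE//; apply: ge0_le_integral => //.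
- by move=> x _; apply: integral_ge0 => z _; rewrite lee_fin divr_ge0 ?powR_ge0//; exact: j'0.
- apply: (measurable_fun_fubini_tonelli_F _ m1) => xz.
  by rewrite lee_fin divr_ge0 ?powR_ge0//; exact: j'0.
- apply: (measurable_fun_fubini_tonelli_F _ m2) => xz.
  by rewrite lee_fin divr_ge0 ?powR_ge0//; exact: j0.
move=> x _; apply: ge0_le_integral => //.
- by move=> z _; rewrite lee_fin divr_ge0 ?powR_ge0//; exact: j'0.
- exact: (measurableT_comp m1 (pair1_measurable x)).
- exact: (measurableT_comp m2 (pair1_measurable x)).
- by move=> z _; apply: le_kern; exact: jj'.
Qed.

(** [Rint_jumps] gives twice the covariance and [jump_comparison] the constant [2 / C k]; the
    factors 2 cancel. *)
Lemma cov_le_energy k f g : bdm f -> bdm g ->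
  (forall x y, 0 <= (f x - f y) * (g x - g y))%R ->
  (cov mu k f g)%:E <= (C k)^-1%:E * energy k f g.
Proof.
move=> bf bg fg; have [[mf _] [mg _]] := (bf, bg).
have bj := bdm_jumps mu k bf bg.
have E : (2 * cov mu k f g)%:E =
    \int[mu]_x \int[mu]_y (jump f g x (upd k x (y ord0 k)))%:E.
  rewrite -(Rint_jumps probV prodmu k bf bg) EFin_Rintegral; last exact: bdm_integrable.
  apply: eq_integral => x _; rewrite EFin_Rintegral//; apply: bdm_integrable.
  apply: bdmM; apply: bdmB; by [exact: bdm_cst|exact: bdm_upd].
have H : (2 * cov mu k f g)%:E <= (2 / C k)%:E * energy k f g.
  rewrite E energyE//.
  apply: (@jump_comparison R d V mu mV probV prodmu alpha (C k) k (jump f g)) => //.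
  - exact: C_le.
  - exact: mjump.
  - by move=> x; rewrite /jump !subrr mulr0.
  - by move=> x y; rewrite /jump; ring.
by rewrite -(@lee_pmul2l _ 2%:E)// -EFinM muleA -EFinM.
Qed.

(** Meant for truncations [f'] and [g'] of [f] and [g]: the covariances need bounded functions, and
    the bound is by the Dirichlet form of the original ones. *)
Lemma sum_cov_le_dirichlet (S : R) f g (f' g' : 'rV[R]_d -> R) : (forall k, (C k)^-1 <= S)%R ->
  measurable_fun [set: 'rV[R]_d] f -> measurable_fun [set: 'rV[R]_d] g ->
  bdm f' -> bdm g' ->
  (forall x y, 0 <= (f' x - f' y) * (g' x - g' y) <= (f x - f y) * (g x - g y))%R ->
  (\sum_(k < d) cov mu k f' g')%:E <= (2 * S)%:E * dirichlet alpha mu f g.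
Proof.
move=> CS mf mg bf bg H; have [[mf' _] [mg' _]] := (bf, bg).
have H0 x y : (0 <= (f x - f y) * (g x - g y))%R.
  by have /andP[h] := H x y; exact: le_trans.
rewrite /dirichlet muleA -EFinM -(mulrC S) mulfK// ge0_sume_distrr; last first.
  by move=> k _; exact: energy_ge0.
rewrite -sumEFin; apply: lee_sum => k _.
have S0 : (0 <= S)%R by rewrite (le_trans _ (CS k))// invr_ge0 ltW.
apply: (@le_trans _ _ ((C k)^-1%:E * energy k f' g')).
  by apply: cov_le_energy => // x y; have /andP[] := H x y.
apply: lee_pmul.
- by rewrite lee_fin invr_ge0 ltW.
- by apply: energy_ge0 => x y; have /andP[] := H x y.
- by rewrite lee_fin.
- exact: le_energy.
Qed.

End dirichlet_bounds.

(** * Square integrability of the elements of the domain *)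

Section square_integrability.
Local Open Scope ereal_scope.

Import HBNNSimple.

(* Meant for [f - g] with [g] in the core: the measurability of [g] for the
   coordinate sigma-algebra is never established. *)
Lemma ge0_le_integralT dT (T : measurableType dT) (R : realType)
    (m : {measure set T -> \bar R}) (f g : T -> \bar R) :
  (forall x, 0 <= f x) -> (forall x, f x <= g x) ->
  \int[m]_x f x <= \int[m]_x g x.
Proof.
move=> f0 fg; rewrite !ge0_integralTE//; last by move=> x; exact: le_trans (fg x).
apply: ereal_sup_le => _ [h hf <-]; exists h => // x.
exact: le_trans (fg x).
Qed.

Lemma Cc_infty_bounded (R : realType) (d : nat) (g : 'rV[R]_d -> R) :
  Cc_infty g -> exists M : R, (0 <= M)%R /\ forall x, (`|g x| <= M)%R.
Proof.
move=> [/(_ 0%N) /= cg cK]; set K := closure _ in cK.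
have : compact (g @` K).
  by apply: continuous_compact => //; exact: continuous_subspaceT.
move=> /compact_bounded[M [Mr HM]].
(* [compact_bounded] provides a bound for every number strictly above [M], and [M] may be
   negative. *)
exists (`|M| + 1)%R; split; first by rewrite addr_ge0.
move=> x; have [->|gx] := eqVneq (g x) 0%R; first by rewrite normr0 addr_ge0.
apply: (HM (`|M| + 1)%R).
  by rewrite (le_lt_trans (ler_norm _))// ltrDl.
by exists x => //; apply: subset_closure.
Qed.

Context (R : realType) (d : nat) (alpha : R) (mu : probability 'rV[R]_d R).

Lemma dirichlet_ge0 (f g : 'rV[R]_d -> R) :
  (forall x y, 0 <= (f x - f y) * (g x - g y))%R -> 0 <= dirichlet alpha mu f g.
Proof.
move=> fg; rewrite /dirichlet mule_ge0// sume_ge0// => k _.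
apply: integral_ge0 => x _; apply: integral_ge0 => z _.
by rewrite lee_fin divr_ge0// powR_ge0.
Qed.

(** A single core function [g] at distance less than 1 suffices: [f - g] has finite second moment
    and [g] is bounded by some [M]. *)
Lemma dirichlet_domain_L2 (f : 'rV[R]_d -> R) : dirichlet_domain alpha mu f ->
  mu.-integrable [set: 'rV[R]_d] (fun x => (f x ^+ 2)%:E).
Proof.
move=> [mf /(_ 1%R ltr01)[g Cg]]; rewrite /dirichlet_norm.
set A := \int[mu]_x _; set B := dirichlet _ _ _ _ => AB.
have A0 : 0 <= A by apply: integral_ge0 => x _; rewrite lee_fin sqr_ge0.
have B0 : 0 <= B by apply: dirichlet_ge0 => x y; rewrite -expr2 sqr_ge0.
have Afin : A < +oo.
  apply: (@le_lt_trans _ _ (A + B)); first by rewrite leeDl.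
  apply: (@lty_poweRy _ _ 2^-1); first by rewrite invr_neq0.
  exact: lt_trans AB (ltry _).
have [M [M0 gM]] := Cc_infty_bounded Cg.
(* A measurable substitute for [f - g]: it is at most [|f - g|], and [|f| <= M + h], whence
   [f ^+ 2 <= 2 * M ^+ 2 + 2 * h ^+ 2]. *)
pose h x := (Num.max (`|f x| - M) 0)%R.
have mh : measurable_fun [set: 'rV[R]_d] h.
  apply: measurable_maxr => //; apply: measurable_funB => //.
  by apply: measurableT_comp => //; exact: normr_measurable.
have hA : \int[mu]_x (h x ^+ 2)%:E <= A.
  apply: ge0_le_integralT => x; rewrite lee_fin ?sqr_ge0//.
  rewrite -[leRHS]real_normK ?num_real// ler_pXn2r ?nnegrE ?le_max ?lexx ?orbT//.
  rewrite /h ge_max normr_ge0 andbT.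
  by have := lerB_dist (f x) (g x); have := gM x; rewrite /=; lra.
have ih : mu.-integrable [set: 'rV[R]_d] (fun x => (h x ^+ 2)%:E).
  apply/integrableP; split; first by apply/measurable_EFinP; exact: measurable_funX.
  under eq_integral do rewrite gee0_abs ?lee_fin ?sqr_ge0//.
  exact: le_lt_trans hA Afin.
have ic : mu.-integrable [set: 'rV[R]_d] (EFin \o cst (2 * M ^+ 2)%R).
  exact: finite_measure_integrable_cst.
apply: (@le_integrable _ _ _ mu _ measurableT _
  (fun x => (EFin \o cst (2 * M ^+ 2)%R) x + 2%:E * (h x ^+ 2)%:E)).
- by apply/measurable_EFinP; exact: measurable_funX.
- move=> x _; rewrite -[X in _ <= `|X|]/((2 * M ^+ 2 + 2 * h x ^+ 2)%R%:E).
  rewrite !abse_EFin lee_fin.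
  rewrite ger0_norm ?sqr_ge0// (le_trans _ (ler_norm _))//.
  rewrite -[leLHS]real_normK ?num_real//.
  have h0 : (0 <= h x)%R by rewrite le_max lexx orbT.
  have fh : (`|f x| <= M + h x)%R by rewrite /h -lerBlDl le_max lexx.
  have := normr_ge0 (f x); have := sqr_ge0 (M - h x)%R; nra.
- by apply: integrableD => //; exact: integrableZl.
Qed.

End square_integrability.

(** * Insensitivity of the Dirichlet form to null sets *)

Section almost_everywhere.
Context (R : realType) (d : nat) (alpha : R) (V : 'I_d -> R -> R)
  (mu : probability 'rV[R]_d R).
Hypothesis mV : forall i, measurable_fun [set: R] (V i).
Hypothesis probV : forall i, gibbs (V i) [set: R] = 1%E.
Hypothesis prodmu : is_product_measure mu (fun i => gibbs (V i)).
Local Open Scope ereal_scope.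

Lemma ge0_integral_eq0_ae dT (T : measurableType dT)
    (m : {measure set T -> \bar R}) (f : T -> \bar R) :
  measurable_fun [set: T] f -> (forall x, 0 <= f x) -> \int[m]_x f x = 0 ->
  {ae m, forall x, f x = 0}.
Proof.
move=> mf f0 If; have /filterS : ae_eq m setT f (cst 0); last first.
  by apply => x /= /(_ I).
apply/ae_eq_integral_abs => //.
by rewrite -[RHS]If; apply: eq_integral => x _; rewrite gee0_abs.
Qed.

(* The density of the k-th marginal is positive, so mu-null sets have
   Lebesgue-null lines. *)
Lemma ae_null_lines (k : 'I_d) (N : set 'rV[R]_d) : measurable N -> mu N = 0 ->
  {ae mu, forall x, {ae (@lebR R), forall z, ~ N (upd k x (x ord0 k + z))}}.
Proof.
move=> mN N0.
pose F (x : 'rV[R]_d) : \bar R := (\1_N x)%:E.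
have mF : measurable_fun [set: 'rV[R]_d] F.
  by apply/measurable_EFinP; exact: measurable_indic.
have F0 x : 0 <= F x by rewrite lee_fin.
have : \int[mu]_x F x = 0 by rewrite integral_indic// setIT.
rewrite (ge0_integral_resample_density mV probV prodmu k mF F0).
move=> /ge0_integral_eq0_ae; have p0 t : 0 <= (expR (- V k t))%:E by rewrite lee_fin expR_ge0.
have mG : measurable_fun [set: 'rV[R]_d * R]
    (fun xt => F (upd k xt.1 xt.2) * (expR (- V k xt.2))%:E).
  apply: emeasurable_funM.
    by apply: (measurableT_comp mF); exact: measurable_upd.
  apply/measurable_EFinP.
  by apply: (measurableT_comp (measurable_expRN mV k)); exact: measurable_snd.
move=> H; have {H} : {ae mu, forall x,
    \int[@lebR R]_t (F (upd k x t) * (expR (- V k t))%:E) = 0}.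
  apply: H; last by move=> x; apply: integral_ge0 => t _; exact: mule_ge0.
  by apply: (measurable_fun_fubini_tonelli_F _ mG) => xt; exact: mule_ge0.
apply: filterS => x.
have mGx := measurableT_comp mG (pair1_measurable x).
rewrite (ge0_integral_lebR_shift (x ord0 k))//; last by move=> t; exact: mule_ge0.
move=> /ge0_integral_eq0_ae H; apply: filterS (H _ _) => [z| |z].
- move=> /eqP; rewrite mule_eq0 => /orP[|]; rewrite eqe.
    by move=> h Nz; move: h; rewrite indicE mem_set// oner_eq0.
  by rewrite gt_eqF// expR_gt0.
- have ms : measurable_fun [set: R] (fun z => x ord0 k + z)%R.
    exact: measurable_funD.
  exact: (measurableT_comp mGx ms).
- exact: mule_ge0.
Qed.

(** For almost every [x], the point [x] and almost all points of its line in direction k avoid [N],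
    so the inner integrands agree for almost every jump. *)
Lemma energy_ae_eq k (f g f' g' : 'rV[R]_d -> R) :
  measurable_fun [set: 'rV[R]_d] f -> measurable_fun [set: 'rV[R]_d] g ->
  measurable_fun [set: 'rV[R]_d] f' -> measurable_fun [set: 'rV[R]_d] g' ->
  forall N : set 'rV[R]_d, measurable N -> mu N = 0 ->
  (forall x, ~ N x -> f x = f' x /\ g x = g' x) ->
  energy alpha mu k f g = energy alpha mu k f' g'.
Proof.
move=> mf mg mf' mg' N mN N0 E.
pose K (f g : 'rV[R]_d -> R) (xz : 'rV[R]_d * R) : \bar R :=
  ((f xz.1 - f (upd k xz.1 (xz.1 ord0 k + xz.2))) *
   (g xz.1 - g (upd k xz.1 (xz.1 ord0 k + xz.2))) / `|xz.2| `^ (1 + alpha))%:E.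
have mK f1 g1 : measurable_fun [set: 'rV[R]_d] f1 ->
    measurable_fun [set: 'rV[R]_d] g1 -> measurable_fun [set: 'rV[R]_d * R] (K f1 g1).
  move=> m1 m2.
  have mu1 : measurable_fun [set: 'rV[R]_d * R]
      (fun xz => upd k xz.1 (xz.1 ord0 k + xz.2)).
    apply: measurable_upd => //; apply: measurable_funD => //.
    exact: (measurableT_comp (measurable_coord k)).
  apply/measurable_EFinP/measurable_funM.
    apply: measurable_funM; apply: measurable_funB.
    - exact: (measurableT_comp m1).
    - exact: (measurableT_comp m1).
    - exact: (measurableT_comp m2).
    - exact: (measurableT_comp m2).
  exact: measurable_inv_powR_norm.
have mIK f1 g1 : measurable_fun [set: 'rV[R]_d] f1 ->
    measurable_fun [set: 'rV[R]_d] g1 ->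
    measurable_fun [set: 'rV[R]_d] (fun x => \int[@lebR R]_z K f1 g1 (x, z)).
  move=> m1 m2; have mk := mK _ _ m1 m2.
  (* The product of increments has no sign here, so Tonelli is applied to its positive and negative
     parts. *)
  rewrite [X in measurable_fun _ X](_ : _ = fun x =>
    \int[@lebR R]_z (K f1 g1)^\+ (x, z) - \int[@lebR R]_z (K f1 g1)^\- (x, z)).
    apply: emeasurable_funB.
      exact: (measurable_fun_fubini_tonelli_F _ (measurable_funepos mk)).
    exact: (measurable_fun_fubini_tonelli_F _ (measurable_funeneg mk)).
  apply/funext => x; rewrite [LHS]integralE.
  under eq_integral do rewrite funepos_comp/=.
  by under [X in _ - X = _]eq_integral do rewrite funeneg_comp/=.
rewrite !energyE//.
apply: (@ae_eq_integral _ _ _ mu setT (fun x => \int[@lebR R]_z K f' g' (x, z))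
  (fun x => \int[@lebR R]_z K f g (x, z))) => //; [exact: mIK|exact: mIK|].
have aN : {ae mu, forall x, ~ N x}.
  by exists N; split => // x /= /contrapT.
apply: filterS2 aN (ae_null_lines k mN N0) => x Nx Hz _.
apply: ae_eq_integral => //.
- exact: (measurableT_comp (mK _ _ mf mg) (pair1_measurable x)).
- exact: (measurableT_comp (mK _ _ mf' mg') (pair1_measurable x)).
apply: filterS Hz => z Nz _.
by rewrite /K /=; have [-> ->] := E _ Nx; have [-> ->] := E _ Nz.
Qed.

End almost_everywhere.

(** * Truncation and passage to the limit *)

Section truncation.
Context (R : realType).

Definition clamp (a b t : R) : R := Num.max a (Num.min t b).

Lemma clamp_bounds a b t : a <= b -> a <= clamp a b t <= b.
Proof. by move=> ab; rewrite /clamp le_max lexx /= ge_max ab ge_min lexx orbT. Qed.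

Lemma clamp_id a b t : a <= t <= b -> clamp a b t = t.
Proof. by move=> /andP[at_ tb]; rewrite /clamp min_l// max_r. Qed.

Lemma clampB a b u v : u <= v -> 0 <= clamp a b v - clamp a b u <= v - u.
Proof.
by move=> uv; rewrite /clamp /Num.max /Num.min;
  repeat case: ifPn => //; rewrite -?leNgt => *; apply/andP; split; lra.
Qed.

(** Truncating f therefore truncates log f, and [clamp_jump] applies to the pair. *)
Lemma ln_clamp a b t : 0 < a -> a <= b -> 0 < t ->
  ln (clamp a b t) = clamp (ln a) (ln b) (ln t).
Proof.
move=> a0 ab t0; have b0 : 0 < b by exact: lt_le_trans ab.
rewrite /clamp /Num.min ltr_ln//; case: ifP => _; rewrite /Num.max ltr_ln//; by case: ifP.
Qed.

(** [clamp] is nondecreasing and 1-Lipschitz, and the hypotheses order [p], [q] like [u], [v]; so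
    both increments keep their common sign and shrink. *)
Lemma clamp_jump (a b a' b' u v p q : R) : (u <= v -> p <= q) -> (v <= u -> q <= p) ->
  0 <= (clamp a b u - clamp a b v) * (clamp a' b' p - clamp a' b' q) <=
  (u - v) * (p - q).
Proof.
have sw (x y z w : R) : (x - y) * (z - w) = (y - x) * (w - z) by ring.
have aux (u1 v1 p1 q1 : R) : u1 <= v1 -> p1 <= q1 ->
    0 <= (clamp a b u1 - clamp a b v1) * (clamp a' b' p1 - clamp a' b' q1) <=
    (u1 - v1) * (p1 - q1).
  move=> h1 h2; have /andP[c1 c2] := clampB a b h1.
  have /andP[c3 c4] := clampB a' b' h2.
  by rewrite sw (sw u1) mulr_ge0//= ler_pM.
move=> H1 H2; case: (leP u v) => [uv|/ltW vu]; first exact: aux (H1 uv).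
by rewrite sw (sw u); exact: aux (H2 vu).
Qed.

(** Apply [1 + s <= expR s] at [s = ln t] for the upper bound and at [s = - ln t] for the lower
    one. *)
Lemma normr_mul_ln (t : R) : 0 < t -> `|t * ln t| <= 1 + t ^+ 2.
Proof.
move=> t0; have h1 := expR_ge1Dx (ln t); have h2 := expR_ge1Dx (- ln t).
rewrite lnK ?posrE// in h1; rewrite expRN lnK ?posrE// in h2.
have h3 : t * (1 - ln t) <= 1 by rewrite -(ler_pM2l t0) divff ?gt_eqF// in h2.
by rewrite ler_norml; apply/andP; split; nra.
Qed.

Lemma EFin_cvg_le (a : R^nat) (l : R) (B : \bar R) :
  a @ \oo --> l -> (forall n, ((a n)%:E <= B)%E) -> (l%:E <= B)%E.
Proof.
case: B => [r| |] al aB; [|by rewrite leey|by have := aB 0%N].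
rewrite lee_fin -(cvg_lim _ al)//; apply: limr_le; first by apply/cvg_ex; exists l.
by apply: nearW => n; rewrite -lee_fin.
Qed.

End truncation.

Section dominated.
Context dT (T : measurableType dT) (R : realType) (m : {measure set T -> \bar R}).

Lemma Rint_dominated_cvg (u_ : nat -> T -> R) (u g : T -> R) :
  (forall n, measurable_fun [set: T] (u_ n)) -> measurable_fun [set: T] u ->
  (forall x, \forall n \near \oo, u_ n x = u x) ->
  m.-integrable [set: T] (EFin \o g) -> (forall n x, `|u_ n x| <= g x) ->
  m.-integrable [set: T] (EFin \o u) /\
  \int[m]_x u_ n x @[n --> \oo] --> \int[m]_x u x.
Proof.
move=> mu_ mu u_u ig ug.
have cu_ : {ae m, forall x, setT x -> (EFin \o u_ n) x @[n --> \oo] --> (EFin \o u) x}.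
  apply: aeW => x _; apply: cvg_near_cst.
  by apply: filterS (u_u x) => n /= ->.
have bu : {ae m, forall x n, setT x -> (`|(EFin \o u_ n) x| <= (EFin \o g) x)%E}.
  by apply: aeW => x n _; rewrite lee_fin.
have [iu _ cu] := @dominated_convergence _ T R m setT measurableT
  (fun n => EFin \o u_ n) (EFin \o u) (EFin \o g)
  (fun n => (measurable_EFinP _ _).2 (mu_ n)) ((measurable_EFinP _ _).2 mu)
  cu_ ig bu.
split => //; apply: fine_cvg; rewrite fineK//.
exact: integrable_fin_num.
Qed.

End dominated.

(** * The Poincaré and entropy inequalities *)

Section inequalities.
Context (R : realType) (d : nat) (alpha : R) (V : 'I_d -> R -> R)
  (mu : probability 'rV[R]_d R) (C : 'I_d -> R) (S : R).
Hypothesis mV : forall i, measurable_fun [set: R] (V i).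
Hypothesis probV : forall i, gibbs (V i) [set: R] = 1%E.
Hypothesis prodmu : is_product_measure mu (fun i => gibbs (V i)).
Hypothesis C_gt0 : forall i, 0 < C i.
Hypothesis C_le : forall i (x y : R), x != y ->
  C i <= (expR (V i x) + expR (V i y)) / `|x - y| `^ (1 + alpha).
Hypothesis CS : forall i, (C i)^-1 <= S.

Lemma measurable_clamp a b (f : 'rV[R]_d -> R) : measurable_fun [set: 'rV[R]_d] f ->
  measurable_fun [set: 'rV[R]_d] (fun x => clamp a b (f x)).
Proof.
move=> mf; apply: measurable_maxr; first exact: measurable_cst.
by apply: measurable_minr => //; exact: measurable_cst.
Qed.

Lemma bdm_clamp a b (f : 'rV[R]_d -> R) : a <= b ->
  measurable_fun [set: 'rV[R]_d] f -> bdm (fun x => clamp a b (f x)).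
Proof.
move=> ab mf; split; first exact: measurable_clamp.
exists (`|a| + `|b|) => x; have /andP[h1 h2] := clamp_bounds (f x) ab.
rewrite ler_norml; apply/andP; split.
  by have := ler_norm (- a); rewrite normrN; have := normr_ge0 b; lra.
by have := ler_norm b; have := normr_ge0 a; lra.
Qed.

Section square_integrable.
Context (f : 'rV[R]_d -> R).
Hypothesis mf : measurable_fun [set: 'rV[R]_d] f.
Hypothesis f2 : mu.-integrable [set: 'rV[R]_d] (fun x => (f x ^+ 2)%:E).

(** One dominating function for every limit below. The 2 adds the 1 of [normr_mul_ln] to the 1 in
    the bound of a squared truncation by [1 + f x ^+ 2]. *)
Let ig : mu.-integrable [set: 'rV[R]_d] (EFin \o (fun x => 2 + f x ^+ 2)).
Proof.
have ic : mu.-integrable [set: 'rV[R]_d] (EFin \o cst (2 : R)).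
  exact: finite_measure_integrable_cst.
exact: integrableD ic f2.
Qed.

Lemma poincare_L2 :
  (\int[mu]_x (f x ^+ 2)%:E <=
   (2 * S)%:E * dirichlet alpha mu f f + (\int[mu]_x (f x)%:E) ^+ 2)%E.
Proof.
pose u n x := clamp (- n%:R) n%:R (f x).
have nn (n : nat) : - n%:R <= n%:R :> R by rewrite ge0_cp.
have bu n : bdm (u n) by exact: bdm_clamp.
have uf n x : `|u n x| <= `|f x|.
  (* As 0 is fixed, comparing [f x] with 0 shows that truncation does not increase absolute
     values. *)
  have c0 : clamp (- n%:R) n%:R 0 = 0 :> R.
    by apply: clamp_id; rewrite oppr_le0 ler0n.
  rewrite /u; case: (leP 0 (f x)) => [f0|/ltW f0].
    have := clampB (- n%:R) n%:R f0; rewrite c0 !subr0 => /andP[h1 h2].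
    by rewrite !ger0_norm.
  have := clampB (- n%:R) n%:R f0; rewrite c0 !sub0r => /andP[h1 h2].
  by rewrite !ler0_norm// -oppr_ge0.
have ue x : \forall n \near \oo, u n x = f x.
  apply: filterS (nbhs_infty_ger `|f x|) => n fn.
  by apply: clamp_id; rewrite -ler_norml.
have [if1 c1] : mu.-integrable setT (EFin \o f) /\
    \int[mu]_x u n x @[n --> \oo] --> \int[mu]_x f x.
  apply: (Rint_dominated_cvg (u_ := u) _ _ _ ig) => //.
  - by move=> n; exact: (bu n).1.
  - move=> n x; rewrite (le_trans (uf n x))// -[f x ^+ 2]real_normK ?num_real//.
    have := sqr_ge0 (1 - `|f x|); have := sqr_ge0 `|f x|; nra.
have [if2 c2] : mu.-integrable setT (EFin \o (fun x => f x * f x)) /\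
    \int[mu]_x (u n x * u n x) @[n --> \oo] --> \int[mu]_x (f x * f x).
  apply: (Rint_dominated_cvg (u_ := fun n x => u n x * u n x) _ _ _ ig).
  - by move=> n; exact: (bdmM (bu n) (bu n)).1.
  - exact: measurable_funM.
  - by move=> x; apply: filterS (ue x) => n ->.
  - move=> n x; rewrite normrM -expr2 -[f x ^+ 2]real_normK ?num_real//.
    by rewrite (@le_trans _ _ (`|f x| ^+ 2)) ?lerDr// ler_pXn2r ?nnegrE.
have B n : ((\int[mu]_x (u n x * u n x) - (\int[mu]_x u n x) * (\int[mu]_x u n x))%:E
    <= (2 * S)%:E * dirichlet alpha mu f f)%E.
  apply: (@le_trans _ _ (\sum_(k < d) cov mu k (u n) (u n))%:E).
    by rewrite lee_fin; exact: (variance_tensorisation probV prodmu).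
  apply: (sum_cov_le_dirichlet mV probV prodmu C_gt0 C_le CS) => // x y.
  exact: clamp_jump.
have cB : \int[mu]_x (u n x * u n x) - (\int[mu]_x u n x) * (\int[mu]_x u n x) @[n --> \oo]
    --> \int[mu]_x (f x * f x) - (\int[mu]_x f x) * (\int[mu]_x f x).
  by apply: cvgB => //; exact: cvgM.
have := EFin_cvg_le cB B.
rewrite EFinB (EFin_Rintegral if2) EFinM (EFin_Rintegral if1).
rewrite -expe2 leeBlDr; last by rewrite fin_numX//; exact: (integrable_fin_num _ if1).
by under [X in (X <= _)%E -> _]eq_integral do rewrite -expr2.
Qed.

Lemma entropy_L2 : (forall x, 0 < f x) ->
  (entropy mu f <=
   (2 * S)%:E * dirichlet alpha mu f (fun x => ln (f x)))%E.
Proof.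
move=> f0.
(* The successor keeps [e 0] positive, and [e n <= 1 <= M n] makes the truncation at most the
   maximum of 1 and [f]. *)
pose e (n : nat) : R := n.+1%:R^-1; pose M (n : nat) : R := n.+1%:R.
have e0 n : 0 < e n by rewrite invr_gt0.
have e1 n : e n <= 1 by rewrite invf_le1// ler1n.
have M1 n : 1 <= M n by rewrite ler1n.
have eM n : e n <= M n by exact: le_trans (M1 n).
pose u n x := clamp (e n) (M n) (f x).
have ub n x : e n <= u n x <= M n by exact: clamp_bounds.
have u0 n x : 0 < u n x by have /andP[+ _] := ub n x; exact: lt_le_trans.
have bu n : bdm (u n) by exact: bdm_clamp.
have blu n : bdm (fun x => ln (u n x)) by exact: bdm_ln (bu n).1 (e0 n) (ub n).
have u2 n x : u n x ^+ 2 <= 1 + f x ^+ 2.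
  have : u n x <= Num.max 1 (f x).
    rewrite /u /clamp ge_max le_max e1 /= ge_min !le_max lexx orbT //.
  rewrite le_max => /orP[h|h].
    by have := sqr_ge0 (f x); have := u0 n x; nra.
  by have := u0 n x; nra.
have ue x : \forall n \near \oo, u n x = f x.
  (* Beyond the sum of [f x] and its inverse, neither truncation level acts at [x]. *)
  apply: filterS (nbhs_infty_ger (f x + (f x)^-1)) => n fn.
  have v0 : 0 < (f x)^-1 by rewrite invr_gt0.
  have nM : n%:R <= M n by rewrite ler_nat.
  apply: clamp_id; apply/andP; split; last by have := f0 x; lra.
  rewrite /e -[leRHS]invrK lef_pV2 ?posrE//; have := f0 x; rewrite -/(M n); lra.
have [if1 c1] : mu.-integrable setT (EFin \o f) /\
    \int[mu]_x u n x @[n --> \oo] --> \int[mu]_x f x.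
  apply: (Rint_dominated_cvg (u_ := u) _ _ _ ig) => //.
  - by move=> n; exact: (bu n).1.
  - move=> n x; rewrite gtr0_norm//; have := u2 n x; have := sqr_ge0 (u n x - 1); nra.
have mln (g : 'rV[R]_d -> R) : measurable_fun [set: 'rV[R]_d] g ->
    measurable_fun [set: 'rV[R]_d] (fun x => ln (g x)).
  by move=> mg; exact: (measurableT_comp (@measurable_ln R)).
have [if2 c2] : mu.-integrable setT (EFin \o (fun x => f x * ln (f x))) /\
    \int[mu]_x (u n x * ln (u n x)) @[n --> \oo] --> \int[mu]_x (f x * ln (f x)).
  apply: (Rint_dominated_cvg (u_ := fun n x => u n x * ln (u n x)) _ _ _ ig).
  - by move=> n; exact: (bdmM (bu n) (blu n)).1.
  - by apply: measurable_funM => //; exact: mln.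
  - by move=> x; apply: filterS (ue x) => n ->.
  - by move=> n x; rewrite (le_trans (normr_mul_ln (u0 n x)))//; have := u2 n x; lra.
set m := \int[mu]_x f x in c1.
have mE : (\int[mu]_x (f x)%:E)%E = m%:E by rewrite EFin_Rintegral.
(* Needed for the continuity of [ln] at [m]. A zero mean would force [f] to vanish almost
   everywhere, although [f] is positive and [mu] has mass 1. *)
have m0 : 0 < m.
  rewrite lt_neqAle; apply/andP; split; last first.
    by apply: Rintegral_ge0 => x _; exact: ltW.
  apply/negP => /eqP m00.
  have /ge0_integral_eq0_ae H : (\int[mu]_x (f x)%:E)%E = 0%E by rewrite mE -m00.
  have {H} [N [mN N0 NT]] : {ae mu, forall x, (f x)%:E = 0%E}.
    by apply: H => [|x]; [exact/measurable_EFinP|rewrite lee_fin ltW].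
  have : mu setT = 0%E.
    rewrite -N0; congr (mu _); apply/seteqP; split => // x _; apply: NT => /= -[fx].
    by have := f0 x; rewrite fx ltxx.
  by rewrite probability_setT => /eqP; rewrite eqe oner_eq0.
have B n : ((\int[mu]_x (u n x * ln (u n x)) -
    (\int[mu]_x u n x) * ln (\int[mu]_x u n x))%:E
    <= (2 * S)%:E * dirichlet alpha mu f (fun x => ln (f x)))%E.
  apply: (@le_trans _ _ (\sum_(k < d) cov mu k (u n) (fun x => ln (u n x)))%:E).
    by rewrite lee_fin; exact: (entropy_tensorisation probV prodmu (e0 n) (bu n) (ub n)).
  apply: (sum_cov_le_dirichlet mV probV prodmu C_gt0 C_le CS) => //.
    exact: mln.
  move=> x y; rewrite /u !ln_clamp//.
  by apply: clamp_jump => h; rewrite ler_ln ?posrE.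
have cm : (\int[mu]_x u n x) * ln (\int[mu]_x u n x) @[n --> \oo] --> m * ln m.
  by apply: cvgM => //; exact: continuous_cvg (continuous_ln m0) c1.
have cB : \int[mu]_x (u n x * ln (u n x)) - (\int[mu]_x u n x) * ln (\int[mu]_x u n x)
    @[n --> \oo] --> \int[mu]_x (f x * ln (f x)) - m * ln m.
  exact: cvgB.
have := EFin_cvg_le cB B.
by rewrite EFinB EFinM (EFin_Rintegral if2) -(lne_EFin m0) -mE.
Qed.

End square_integrable.

(** Giving f the value 1 where it is not positive changes it on a null set only, which neither the
    entropy nor, by [energy_ae_eq], the Dirichlet form detects. *)
Lemma entropy_ae_pos (f : 'rV[R]_d -> R) : measurable_fun [set: 'rV[R]_d] f ->
  mu.-integrable [set: 'rV[R]_d] (fun x => (f x ^+ 2)%:E) ->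
  {ae mu, forall x, 0 < f x} ->
  (entropy mu f <=
   (2 * S)%:E * dirichlet alpha mu f (fun x => ln (f x)))%E.
Proof.
move=> mf f2 [N [mN N0 Npos]].
pose g x := if 0 < f x then f x else 1.
have mg : measurable_fun [set: 'rV[R]_d] g.
  apply: measurable_fun_ifT => //.
  by apply: measurable_fun_ltr => //; exact: measurable_cst.
have g0 x : 0 < g x by rewrite /g; case: ifP.
have fg x : ~ N x -> f x = g x.
  by move=> Nx; rewrite /g ifT//; apply: contrapT => /Npos.
have mln (h : 'rV[R]_d -> R) : measurable_fun [set: 'rV[R]_d] h ->
    measurable_fun [set: 'rV[R]_d] (fun x => ln (h x)).
  by move=> mh; exact: (measurableT_comp (@measurable_ln R)).
have fgae : {ae mu, forall x, f x = g x}.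
  by exists N; split => // x /= h; apply: contrapT => /fg.
have g2 : mu.-integrable [set: 'rV[R]_d] (fun x => (g x ^+ 2)%:E).
  have ic : mu.-integrable [set: 'rV[R]_d] (EFin \o cst (1 : R)).
    exact: finite_measure_integrable_cst.
  apply: (@le_integrable _ _ _ mu _ measurableT _ _ _ _ (integrableD measurableT ic f2)).
    by apply/measurable_EFinP; exact: measurable_funX.
  move=> x _; rewrite -[X in (_ <= `|X|)%E]/((1 + f x ^+ 2)%R%:E) !abse_EFin lee_fin.
  rewrite !ger0_norm ?sqr_ge0 ?addr_ge0 ?sqr_ge0// /g.
  by case: ifP => _; rewrite ?expr1n ?lerDr ?lerDl ?sqr_ge0.
have -> : entropy mu f = entropy mu g.
  have E1 : (\int[mu]_x (f x)%:E = \int[mu]_x (g x)%:E)%E.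
    apply: ae_eq_integral => //; [exact/measurable_EFinP|exact/measurable_EFinP|].
    by apply: filterS fgae => x ->.
  rewrite /entropy E1; congr (_ - _)%E.
  apply: ae_eq_integral => //.
  - by apply/measurable_EFinP/measurable_funM => //; exact: mln.
  - by apply/measurable_EFinP/measurable_funM => //; exact: mln.
  - by apply: filterS fgae => x ->.
have -> : dirichlet alpha mu f (fun x => ln (f x)) =
    dirichlet alpha mu g (fun x => ln (g x)).
  apply: (congr1 (mule 2^-1%:E)); apply: eq_bigr => k _.
  apply: (energy_ae_eq alpha mV probV prodmu k _ _ _ _ mN N0) => //; try exact: mln.
  by move=> x /fg ->.
exact: entropy_L2.
Qed.

End inequalities.

Theorem theorem3p1 (R : realType) (d : nat) (alpha : R) (V : 'I_d -> R -> R)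
    (mu : probability 'rV[R]_d R) (C : 'I_d -> R)
    (d_ge1 : (1 <= d)%N)
    (alpha_gt0 : 0 < alpha) (alpha_lt2 : alpha < 2)
    (measV : forall i, measurable_fun [set: R] (V i))
    (probV : forall i, gibbs (V i) [set: R] = 1%E)
    (prodmu : is_product_measure mu (fun i => gibbs (V i)))
    (C_gt0 : forall i, 0 < C i)
    (C_le : forall i (x y : R), x != y ->
       C i <= (expR (V i x) + expR (V i y)) / `|x - y| `^ (1 + alpha)) :
  (forall f : 'rV[R]_d -> R, dirichlet_domain alpha mu f ->
     {ae mu, forall x, 0 < f x} ->
     (entropy mu f <=
        (2 * sup [set (C i)^-1 | i in [set: 'I_d]])%:E
        * dirichlet alpha mu f (fun x => ln (f x)))%E) /\
  (exists2 K : R, 0 < K &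
     forall f : 'rV[R]_d -> R, dirichlet_domain alpha mu f ->
     (\int[mu]_x (f x ^+ 2)%:E <=
        K%:E * dirichlet alpha mu f f + (\int[mu]_x (f x)%:E) ^+ 2)%E).
Proof.
have ub : has_ubound [set (C i)^-1 | i in [set: 'I_d]].
  exists (\sum_(i < d) (C i)^-1) => _ [i _ <-].
  by rewrite (bigD1 i)//= lerDl sumr_ge0// => j _; rewrite invr_ge0 ltW.
have CS i : (C i)^-1 <= sup [set (C i)^-1 | i in [set: 'I_d]].
  by apply: ub_le_sup => //; exists i.
split=> [f Df fpos|].
  apply: (entropy_ae_pos measV probV prodmu C_gt0 C_le CS) => //; first by case: Df.
  exact: dirichlet_domain_L2 Df.
exists (2 * sup [set (C i)^-1 | i in [set: 'I_d]]).
  (* [d >= 1] provides an index, so the supremum is at least some positive [(C i)^-1]. *)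
  have i := Ordinal d_ge1.
  by rewrite mulr_gt0// (lt_le_trans _ (CS i))// invr_gt0.
move=> f Df; apply: (poincare_L2 measV probV prodmu C_gt0 C_le CS); first by case: Df.
exact: dirichlet_domain_L2 Df.
Qed.
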